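(* Let $(Y,d_Y)$ be a length space, and let $\alpha>0$. Then $\mathbb{H}_\alpha(Y)$ is Gromov $\delta$-hyperbolic with $\delta=\delta(\alpha)$ depending only on $\alpha$, and if $Y$ is bounded, then $\mathbb{H}^\circ_\alpha(Y)$ is Gromov $\delta$-hyperbolic with $\delta=\delta(\alpha,\operatorname{diam}(Y))$ depending only on $\alpha$ and $\operatorname{diam}(Y)$. Moreover, if $Y$ is a complete bounded length space, then for small enough values of $\varepsilon>0$, the Gromov boundaries $\partial_G\mathbb{H}_\alpha(Y)$ and $\partial_G\mathbb{H}^\circ_\alpha(Y)$, equipped with their standard induced distance $d_\varepsilon$, are quasisymmetrically homeomorphic to $Y$.
   Context: **Paths.** A path in a (pseudo)metric space $(Z,d_Z)$ is a continuous map $\gamma:[a,b]\to Z$; $\operatorname{len}_{d_Z}(\gamma)$ is the supremum of $\sum_i d_Z(\gamma(t_{i-1}),\gamma(t_i))$ over partitions; $\gamma$ is rectifiable if this is finite, and a rectifiable $\gamma$ is absolutely continuous if $t\mapsto \operatorname{len}_{d_Z}(\gamma|_{[a,t]})$ is absolutely continuous. The metric speed is $|\gamma'(t)|=\lim_{u\to t} d_Z(\gamma(u),\gamma(t))/|u-t|$ (exists a.e. for absolutely continuous $\gamma$). $(Z,d_Z)$ is a length space if any two points are joined by a rectifiable path and $d_Z(x,y)$ is the infimum of lengths of rectifiable paths from $x$ to $y$. **Warped products.** Fix a norm $\|\cdot\|$ on $\mathbb{R}^2$ that is unitary ($\|(1,0)\|=\|(0,1)\|=1$) and coordinate-increasing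 ($\|(a,c)\|\le\|(b,d)\|$ whenever $0\le a\le b$, $0\le c\le d$); the choice is arbitrary. For length spaces $X,Y$ and continuous $\varphi:X\to[0,\infty)$, and for a path $\gamma=(\gamma_X,\gamma_Y):[a,b]\to X\times Y$ absolutely continuous with respect to the $\ell^1$-product metric, set $\ell_\varphi(\gamma)=\int_a^b\|(|\gamma_X'(t)|,\varphi(\gamma_X(t))|\gamma_Y'(t)|)\|\,dt$. Let $d_\varphi((x,y),(x',y'))=\inf_\gamma\ell_\varphi(\gamma)$ over absolutely continuous paths from $(x,y)$ to $(x',y')$ (a pseudometric). $X\times_\varphi Y$ is the quotient of $X\times Y$ identifying points at $d_\varphi$-distance $0$, with the induced metric $d_\varphi$. **Solid hyperbolic fillings.** $\mathbb{H}_\alpha(Y)=[0,\infty)\times_{\psi_\alpha}Y$ with $\psi_\alpha(t)=\sinh^\alpha(t)$, and $\mathbb{H}^\circ_\alpha(Y)=[0,\infty)\times_{\varphi_\alpha}Y$ with $\varphi_\alpha(t)=e^{\alpha t}$, where $[0,\infty)$ has the Euclidean metric. **Gromov hyperbolicity.** In a metric space $(Z,d_Z)$, the Gromov product is $\langle x|y\rangle_w=\frac12(d_Z(x,w)+d_Z(y,w)-d_Z(x,y))$. $Z$ is Gromov $\delta$-hyperbolic ($\delta\ge0$) if $\langle x|y\rangle_w\ge\min\{\langle x|z\rangle_w,\langle y|z\rangle_w\}-\delta$ for all $x,y,z,w\in Z$. Fix a base point $x_0\in Z$. A sequence $(x_i)$ is a Gromov sequence if $\lim_{i,j\to\infty}\langle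 x_i|x_j\rangle_{x_0}=\infty$. The Gromov boundary $\partial_GZ$ is the set of Gromov sequences modulo the equivalence $(x_i)\sim(y_i)$ iff $\lim_{i\to\infty}\langle x_i|y_i\rangle_{x_0}=\infty$. For $\overline x,\overline y\in\partial_GZ$, $\langle\overline x|\overline y\rangle_{x_0}=\inf\{\liminf_{i,j\to\infty}\langle x_i|y_j\rangle_{x_0}:(x_i)\in\overline x,(y_i)\in\overline y\}$, $\tilde d_\varepsilon(\overline x,\overline y)=e^{-\varepsilon\langle\overline x|\overline y\rangle_{x_0}}$ (with $e^{-\infty}=0$), and $d_\varepsilon(\overline x,\overline y)=\inf\sum_{i=1}^k\tilde d_\varepsilon(\overline x_{i-1},\overline x_i)$ over finite chains $\overline x=\overline x_0,\dots,\overline x_k=\overline y$ in $\partial_GZ$. **Quasisymmetry.** Given a homeomorphism $\eta:[0,\infty)\to[0,\infty)$, a map $f:Z\to W$ of metric spaces is $\eta$-quasisymmetric if $\frac{d_W(f(x),f(y))}{d_W(f(x),f(z))}\le\eta\left(\frac{d_Z(x,y)}{d_Z(x,z)}\right)$ for all triples of distinct points $x,y,z\in Z$. Two spaces are quasisymmetrically homeomorphic if there is a homeomorphism between them that is $\eta$-quasisymmetric for some $\eta$. *)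

(* Defs.v *)
From HB Require Import structures.
From mathcomp Require Import all_boot all_order all_algebra.
From mathcomp Require Import all_classical all_reals all_analysis.
Set Implicit Arguments.
Unset Strict Implicit.
Unset Printing Implicit Defensive.
Import Order.TTheory GRing.Theory Num.Theory.
Import numFieldNormedType.Exports.
Local Open Scope classical_set_scope.
Local Open Scope ring_scope.

(* Quotients and Gromov boundaries carry a distance whose metric axioms are
   theorems, so the notions below are stated for a bare function
   [d : Z -> Z -> R]; [is_metric d] says that it is a metric. *)

Definition is_metric (R : realType) (Z : Type) (d : Z -> Z -> R) : Prop :=
  [/\ forall x y, 0 <= d x y,
      forall x y, d x y = 0 <-> x = y,
      forall x y, d x y = d y x &
      forall x y z, d x z <= d x y + d y z].

Definition is_bounded (R : realType) (Z : Type) (d : Z -> Z -> R) : Prop :=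
  has_ubound [set d p.1 p.2 | p in [set: Z * Z]].

Definition diam (R : realType) (Z : Type) (d : Z -> Z -> R) : R :=
  sup [set d p.1 p.2 | p in [set: Z * Z]].

(* The library's [completeType] is pointed, and its limits need a point; this
   is its completeness axiom for a uniform space that may be empty. *)
Definition is_complete (Y : uniformType) : Prop :=
  forall F : set_system Y, ProperFilter F -> cauchy F -> exists y : Y, F --> y.

(** ** Paths *)

(* Paths are total functions [R -> Z]; only their values on [[a, b]] matter. *)
Definition is_path (R : realType) (Z : Type) (d : Z -> Z -> R)
    (a b : R) (g : R -> Z) : Prop :=
  a <= b /\
  forall t, t \in `[a, b] ->
    d (g u) (g t) @[u --> within `[a, b]%classic (nbhs t)] --> (0 : R).

Definition path_length (R : realType) (Z : Type) (d : Z -> Z -> R)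
    (a b : R) (g : R -> Z) : \bar R :=
  ereal_sup
    [set (\sum_(0 <= i < size s)
             d (g (nth b (a :: s) i)) (g (nth b (a :: s) i.+1)))%:E
    | s in itv_partition a b].

Definition rectifiable (R : realType) (Z : Type) (d : Z -> Z -> R)
    (a b : R) (g : R -> Z) : Prop :=
  is_path d a b g /\ (path_length d a b g < +oo)%E.

Definition abs_continuous (R : realType) (a b : R) (f : R -> R) : Prop :=
  forall e : R, 0 < e -> exists2 del : R, 0 < del &
    forall (n : nat) (l r : 'I_n -> R),
      (forall i, [/\ a <= l i, l i <= r i & r i <= b]) ->
      trivIset [set: 'I_n] (fun i => `]l i, r i[%classic) ->
      \sum_(i < n) (r i - l i) < del ->
      \sum_(i < n) `|f (r i) - f (l i)| < e.

Definition abs_continuous_path (R : realType) (Z : Type) (d : Z -> Z -> R)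
    (a b : R) (g : R -> Z) : Prop :=
  rectifiable d a b g /\
  abs_continuous a b (fun t => fine (path_length d a t g)).

(* Equals 0 ([lim]'s default value) where the limit does not exist; along an
   absolutely continuous path this is a null set. *)
Definition metric_speed (R : realType) (Z : Type) (d : Z -> Z -> R)
    (a b : R) (g : R -> Z) (t : R) : R :=
  lim (d (g u) (g t) / `|u - t| @[u --> within `[a, b]%classic t^']).

Definition length_space (R : realType) (Z : Type) (d : Z -> Z -> R) : Prop :=
  forall x y : Z,
    (exists (a b : R) (g : R -> Z),
      [/\ rectifiable d a b g, g a = x & g b = y]) /\
    (d x y)%:E = ereal_inf
      [set l | exists (a b : R) (g : R -> Z),
        [/\ rectifiable d a b g, g a = x, g b = y & l = path_length d a b g]].

(** ** Warped products *)

Definition is_norm2 (R : realType) (N : R * R -> R) : Prop :=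
  [/\ forall p, N p = 0 -> p = 0,
      forall (c : R) p, N (c * p.1, c * p.2) = `|c| * N p &
      forall p q, N (p + q) <= N p + N q].

Definition unitary_norm (R : realType) (N : R * R -> R) : Prop :=
  N (1, 0) = 1 /\ N (0, 1) = 1.

Definition coordinate_increasing (R : realType) (N : R * R -> R) : Prop :=
  forall a b c e : R, 0 <= a -> a <= b -> 0 <= c -> c <= e ->
    N (a, c) <= N (b, e).

Definition l1_dist (R : realType) (X Y : Type)
    (dX : X -> X -> R) (dY : Y -> Y -> R) (p q : X * Y) : R :=
  dX p.1 q.1 + dY p.2 q.2.

Definition warped_length (R : realType) (N : R * R -> R) (X Y : Type)
    (dX : X -> X -> R) (dY : Y -> Y -> R) (phi : X -> R)
    (a b : R) (g : R -> X * Y) : \bar R :=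
  (\int[@lebesgue_measure R]_(t in `[a, b])
     (N (metric_speed dX a b (fst \o g) t,
         phi (g t).1 * metric_speed dY a b (snd \o g) t))%:E)%E.

Definition warped_pdist (R : realType) (N : R * R -> R) (X Y : Type)
    (dX : X -> X -> R) (dY : Y -> Y -> R) (phi : X -> R)
    (p q : X * Y) : R :=
  fine (ereal_inf
    [set l | exists (a b : R) (g : R -> X * Y),
      [/\ abs_continuous_path (l1_dist dX dY) a b g, g a = p, g b = q &
          l = warped_length N dX dY phi a b g]]).

(* The set of classes of a relation; defined without a proof that [E] is an
   equivalence. *)
Definition quotient (T : Type) (E : T -> T -> Prop) : Type :=
  {C : set T | exists p, C = [set q | E p q]}.

Definition quotient_repr (T : Type) (E : T -> T -> Prop) (C : quotient E) : T :=
  sval (cid (svalP C)).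

Definition warped_product (R : realType) (N : R * R -> R) (X Y : Type)
    (dX : X -> X -> R) (dY : Y -> Y -> R) (phi : X -> R) : Type :=
  quotient (fun p q => warped_pdist N dX dY phi p q = 0).

Definition warped_dist (R : realType) (N : R * R -> R) (X Y : Type)
    (dX : X -> X -> R) (dY : Y -> Y -> R) (phi : X -> R)
    (C D : warped_product N dX dY phi) : R :=
  warped_pdist N dX dY phi (quotient_repr C) (quotient_repr D).

(** ** Solid hyperbolic fillings *)

Definition euclid_dist (R : realType) (s t : {nonneg R}) : R :=
  `|s%:num - t%:num|.

Definition sinh (R : realType) (t : R) : R := (expR t - expR (- t)) / 2.

Definition psi (R : realType) (alpha : R) (t : {nonneg R}) : R :=
  sinh t%:num `^ alpha.

Definition varphi (R : realType) (alpha : R) (t : {nonneg R}) : R :=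
  expR (alpha * t%:num).

Definition filling (R : realType) (N : R * R -> R) (alpha : R)
    (Y : metricType R) : Type :=
  warped_product N (@euclid_dist R) (@mdist R Y) (psi alpha).

Definition filling_dist (R : realType) (N : R * R -> R) (alpha : R)
    (Y : metricType R) : filling N alpha Y -> filling N alpha Y -> R :=
  @warped_dist R N _ _ (@euclid_dist R) (@mdist R Y) (psi alpha).

Definition filling0 (R : realType) (N : R * R -> R) (alpha : R)
    (Y : metricType R) : Type :=
  warped_product N (@euclid_dist R) (@mdist R Y) (varphi alpha).

Definition filling0_dist (R : realType) (N : R * R -> R) (alpha : R)
    (Y : metricType R) : filling0 N alpha Y -> filling0 N alpha Y -> R :=
  @warped_dist R N _ _ (@euclid_dist R) (@mdist R Y) (varphi alpha).

(** ** Gromov hyperbolicity and boundary *)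

Definition gromov_product (R : realType) (Z : Type) (d : Z -> Z -> R)
    (w x y : Z) : R :=
  (d x w + d y w - d x y) / 2.

Definition gromov_hyperbolic (R : realType) (Z : Type) (d : Z -> Z -> R)
    (delta : R) : Prop :=
  [/\ is_metric d, 0 <= delta &
      forall x y z w : Z,
        Num.min (gromov_product d w x z) (gromov_product d w y z) - delta
          <= gromov_product d w x y].

Definition is_gromov_sequence (R : realType) (Z : Type) (d : Z -> Z -> R)
    (x0 : Z) (u : nat -> Z) : Prop :=
  gromov_product d x0 (u ij.1) (u ij.2) @[ij --> filter_prod \oo \oo] --> +oo%R.

Definition gromov_sequence (R : realType) (Z : Type) (d : Z -> Z -> R)
    (x0 : Z) : Type :=
  {u : nat -> Z | is_gromov_sequence d x0 u}.

Definition gromov_equiv (R : realType) (Z : Type) (d : Z -> Z -> R)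
    (x0 : Z) (u v : gromov_sequence d x0) : Prop :=
  gromov_product d x0 (sval u i) (sval v i) @[i --> \oo] --> +oo%R.

Definition gromov_boundary (R : realType) (Z : Type) (d : Z -> Z -> R)
    (x0 : Z) : Type :=
  quotient (@gromov_equiv R Z d x0).

Definition boundary_product (R : realType) (Z : Type) (d : Z -> Z -> R)
    (x0 : Z) (x y : gromov_boundary d x0) : \bar R :=
  ereal_inf
    [set l | exists u v : gromov_sequence d x0,
      [/\ sval x u, sval y v &
          l = limf_einf
                (fun ij : nat * nat =>
                   (gromov_product d x0 (sval u ij.1) (sval v ij.2))%:E)
                (filter_prod \oo \oo)]].

Definition boundary_quasidist (R : realType) (Z : Type) (d : Z -> Z -> R)
    (x0 : Z) (eps : R) (x y : gromov_boundary d x0) : R :=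
  fine (expeR (- (eps%:E * boundary_product x y))%E).

(* A chain is the head [x] followed by a sequence [s] ending at [y]. *)
Definition boundary_dist (R : realType) (Z : Type) (d : Z -> Z -> R)
    (x0 : Z) (eps : R) (x y : gromov_boundary d x0) : R :=
  inf [set \sum_(0 <= i < size s)
             boundary_quasidist eps (nth y (x :: s) i) (nth y (x :: s) i.+1)
      | s in [set s | last x s = y]].

(** ** Quasisymmetry *)

Definition dist_continuous (R : realType) (Z W : Type)
    (dZ : Z -> Z -> R) (dW : W -> W -> R) (f : Z -> W) : Prop :=
  forall (x : Z) (e : R), 0 < e -> exists2 del : R, 0 < del &
    forall y, dZ x y < del -> dW (f x) (f y) < e.

Definition homeomorphism (R : realType) (Z W : Type)
    (dZ : Z -> Z -> R) (dW : W -> W -> R) (f : Z -> W) : Prop :=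
  dist_continuous dZ dW f /\
  exists g : W -> Z,
    [/\ cancel f g, cancel g f & dist_continuous dW dZ g].

Definition quasisymmetric (R : realType) (Z W : Type)
    (dZ : Z -> Z -> R) (dW : W -> W -> R)
    (eta : {nonneg R} -> {nonneg R}) (f : Z -> W) : Prop :=
  forall x y z : Z, x <> y -> y <> z -> x <> z ->
    forall r : {nonneg R}, r%:num = dZ x y / dZ x z ->
      dW (f x) (f y) / dW (f x) (f z) <= (eta r)%:num.

Definition quasisymmetrically_homeomorphic (R : realType) (Z W : Type)
    (dZ : Z -> Z -> R) (dW : W -> W -> R) : Prop :=
  [/\ is_metric dZ, is_metric dW &
      exists f : Z -> W, homeomorphism dZ dW f /\
        exists eta : {nonneg R} -> {nonneg R},
          homeomorphism (@euclid_dist R) (@euclid_dist R) eta /\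
          quasisymmetric dZ dW eta f].

(* Main.v *)
Require Import Defs.
From HB Require Import structures.
From mathcomp Require Import all_boot all_order all_algebra.
From mathcomp Require Import all_classical all_reals all_analysis.
From mathcomp Require Import measurable_realfun.
From mathcomp Require Import ring lra.
Set Implicit Arguments.
Unset Strict Implicit.
Unset Printing Implicit Defensive.
Import Order.TTheory GRing.Theory Num.Theory.
Import numFieldNormedType.Exports.
Local Open Scope classical_set_scope.
Local Open Scope ring_scope.

(** Write [W] for the warped distance on the product of the half-line and [Y], and
    for points [p = (s, y)], [q = (t, y')] put

      [rho p q = max (e^{-alpha s}, e^{-alpha t}, min (1, d (y, y')))],
      [confluence p q = - ln (rho p q) / alpha].

    Everything follows from one estimate ([filling_estimate]): [W p q] differs
    from [s + t - 2 confluence p q] by at most a constant that depends only on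
    [alpha] (and on the diameter, if the warping function does not vanish at
    height [0]). The confluence is the height at which a nearly shortest path
    crosses from the fibre of [y] to that of [y'].

    - Upper bound ([filling_upper]): descend from [s] to the confluence height,
      cross, climb to [t]. At that height the crossing costs at most a constant.
    - Lower bound ([profile_lower]): a path of length [L] stays above the heights
      [s - x] and [t - (L - x)] at arc length [x], which meet at
      [c = (s + t - L) / 2]. Moving a distance [dx] at height [h] displaces the
      [Y] coordinate by at most about [e^{- alpha h} dx], so the total
      displacement is dominated by a geometric series with largest term
      [e^{- alpha c}]. Hence [rho p q] is at most a constant times
      [e^{- alpha c}], i.e. [c] is at most the confluence plus a constant.

    The path in the upper bound moves one coordinate at a time, and the lower
    bound uses the norm only through [max (a, b) <= N (a, b)]; this is why the
    constants do not depend on the norm.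

    _Hyperbolicity._ [rho] satisfies the triangle inequality, so the confluence
    satisfies the ultrametric inequality up to [ln 2 / alpha]; by the estimate
    it is the Gromov product up to constants, and the four-point condition
    follows ([approx_four_point]).

    _Boundary._ Gromov products tend to infinity exactly when [rho] tends to
    [0], so a Gromov sequence is one whose heights tend to infinity and whose
    projections to [Y] converge; taking limits identifies the boundary with [Y]
    ([endpoint]). On the boundary, [e^{- eps (x|y)}] is comparable to
    [d (x, y)^{eps / alpha}]. For [eps <= alpha] the exponent is at most [1] and
    this power is itself a metric, so passing to chains loses no more than the
    same multiplicative constant; a metric comparable to a power of another one
    is quasisymmetric to it ([snowflake_quasisymmetric]).

    _Analysis of paths._ The lower bound needs that the metric speed of an
    absolutely continuous path exists almost everywhere and that its integral
    bounds distances ([metric_speed_ae]). Real functions dominated by the length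
    function have densities, by the Radon-Nikodym theorem for Stieltjes measures
    ([stieltjes_density]), and derivatives, by Lebesgue differentiation; the
    metric speed is the supremum of the absolute derivatives of the distances to
    a countable dense set of points of the path. The upper bound needs absolutely
    continuous paths in [Y], which the length space provides only after
    parametrization by arc length ([arclength_param]). *)

(** * Sums along finite chains *)

Section chain_sum.
Context (R : realType) (Z : Type) (q : Z -> Z -> R).

Fixpoint chain_sum x (s : seq Z) : R :=
  if s is z :: s' then q x z + chain_sum z s' else 0.

Lemma chain_sumE x y s :
  \sum_(0 <= i < size s) q (nth y (x :: s) i) (nth y (x :: s) i.+1) = chain_sum x s.
Proof.
elim: s x => [|z s IH] x /=; first by rewrite big_nil.
by rewrite big_nat_recl//= -IH.
Qed.

Lemma chain_sum_cat x s t : chain_sum x (s ++ t) = chain_sum x s + chain_sum (last x s) t.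
Proof. by elim: s x => [|z s IH] x /=; rewrite ?add0r// IH addrA. Qed.

End chain_sum.

(** * Integrals of functions that need not be measurable *)

Section lower_integral.
Context (R : realType).
Notation mu := (@lebesgue_measure R).
Local Open Scope ereal_scope.
Implicit Types (D : set R) (f : R -> \bar R).

Import HBNNSimple.

(** The integral of a nonnegative function is a supremum over simple functions
    below it, so monotonicity holds without measurability. The integrand of the
    warped length agrees with a measurable function only off a null set; arbitrary
    integrands let lengths be cut, shifted and reflected before that is known. *)
Lemma le_integral_lower D f1 f2 : (forall x, D x -> 0 <= f1 x) ->
  (forall x, D x -> f1 x <= f2 x) ->
  \int[mu]_(x in D) f1 x <= \int[mu]_(x in D) f2 x.
Proof.
move=> f10 f12; rewrite !ge0_integralE//; last first.
  by move=> x Dx; apply: le_trans (f12 _ Dx); exact: f10.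
apply: ereal_sup_le => _ [h /= hf <-]; exists h => //= x.
apply: le_trans (hf x) _; rewrite /patch; case: ifPn => // /set_mem; exact: f12.
Qed.

Lemma lower_integral_le D f M : (forall x, D x -> 0 <= f x) ->
  (forall k : R -> R, measurable_fun [set: R] k -> (forall x, (0 <= k x)%R) ->
    (forall x, (k x)%:E <= (f \_ D) x) -> \int[mu]_x (k x)%:E <= M) ->
  \int[mu]_(x in D) f x <= M.
Proof.
move=> f0 H; rewrite ge0_integralE//.
apply: ge_ereal_sup => _ [h /= hf <-]; rewrite -integralT_nnsfun.
apply: H => //; exact: (@measurable_funPT _ _ _ _ h).
Qed.

Lemma le_integral_null D (N : set R) f1 f2 : @measurable _ (measurableTypeR R) N -> mu N = 0 ->
  (forall x, D x -> 0 <= f1 x) -> (forall x, D x -> 0 <= f2 x) ->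
  (forall x, D x -> ~ N x -> f1 x <= f2 x) ->
  \int[mu]_(x in D) f1 x <= \int[mu]_(x in D) f2 x.
Proof.
move=> mN N0 f10 f20 f12; apply: lower_integral_le => // k mk k0 kf.
have -> : \int[mu]_x (k x)%:E = \int[mu]_(x in ~` N) (k x)%:E.
  rewrite -(setvU N) ge0_integral_setU//=.
  - rewrite [X in _ + X](_ : _ = 0) ?adde0//.
    transitivity (\int[mu]_(x in N) `|(k x)%:E|).
      by apply: eq_integral => x _ /=; rewrite ger0_norm.
    by rewrite integral_abs_eq0//; exact/measurable_EFinP/measurable_funTS.
  - exact: measurableC.
  - rewrite setvU; exact/measurable_EFinP.
  - by move=> x _; rewrite lee_fin.
  - by apply/disj_setPS => x [].
rewrite integral_mkcond [leRHS]integral_mkcond.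
apply: le_integral_lower => x _; rewrite /patch.
  by case: ifP; rewrite ?lee_fin.
case: ifPn => [/set_mem Nx|_]; last by case: ifPn => // /set_mem; exact: f20.
apply: le_trans (kf x) _; rewrite /patch; case: ifPn => // /set_mem Dx.
exact: f12.
Qed.

(** Only subadditivity is claimed: this is the direction needed for the length of
    a concatenation, and it holds for every nonnegative [f] and every [B]. *)
Lemma le_integral_split D (A B : set R) f : @measurable _ (measurableTypeR R) A -> D `<=` A `|` B ->
  (forall x, 0 <= f x) ->
  \int[mu]_(x in D) f x <= \int[mu]_(x in A) f x + \int[mu]_(x in B) f x.
Proof.
move=> mA DAB f0; apply: lower_integral_le => // k mk k0 kf.
rewrite -(setvU A) setUC ge0_integral_setU//=.
- apply: leeD; rewrite integral_mkcond [leRHS]integral_mkcond.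
    apply: le_integral_lower => x _; rewrite /patch.
      by case: ifP; rewrite ?lee_fin.
    case: ifPn => // /set_mem Ax; apply: le_trans (kf x) _.
    by rewrite /patch; case: ifP.
  apply: le_integral_lower => x _; rewrite /patch.
    by case: ifP; rewrite ?lee_fin.
  case: ifPn => [/set_mem Ax|_]; last by case: ifP.
  apply: le_trans (kf x) _; rewrite /patch; case: ifPn; last by case: ifP.
  by move=> /set_mem/DAB[//|Bx]; rewrite mem_set.
- exact: measurableC.
- rewrite setUC setvU; exact/measurable_EFinP.
- by move=> x _; rewrite lee_fin.
- by apply/disj_setPS => x [].
Qed.

(** A measurable minorant of [f \o T] becomes, composed with the inverse of [T],
    a measurable minorant of [f] with the same integral; so no measurability of
    [f] is involved. Translations make lengths independent of the parameter
    interval, reflections make the warped distance symmetric. *)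
Lemma integral_isometry_le (T T' : R -> R) D f :
  measurable_fun [set: measurableTypeR R] (T : _ -> measurableTypeR R) ->
  measurable_fun [set: measurableTypeR R] (T' : _ -> measurableTypeR R) ->
  cancel T T' -> cancel T' T ->
  (forall a b : R, mu (T @^-1` `]a, b]%classic) = mu `]a, b]%classic) ->
  (forall x, 0 <= f x) ->
  \int[mu]_(x in T @^-1` D) f (T x) <= \int[mu]_(x in D) f x.
Proof.
move=> mT mT' TT' T'T muab f0.
pose mT_ := isMeasurableFun.Build _ _ _ _ _ mT.
pose Tm : {mfun (measurableTypeR R) >-> (measurableTypeR R)} := HB.pack (T : measurableTypeR R -> measurableTypeR R) mT_.
have muT (A : set (measurableTypeR R)) : measurable A ->
    pushforward mu (T : _ -> measurableTypeR R) A = mu A.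
  move=> mA; apply/esym/(@lebesgue_measure_unique _ (pushforward mu Tm)) => //= _ [[a b]] _ <-.
  by rewrite /pushforward/= muab.
apply: lower_integral_le => // k mk k0 kf.
have -> : \int[mu]_x (k x)%:E = \int[pushforward mu (T : _ -> measurableTypeR R)]_x (k (T' x))%:E.
  rewrite ge0_integral_pushforward//=.
  - by rewrite preimage_setT; apply: eq_integral => x _ /=; rewrite TT'.
  - by apply/measurable_EFinP; exact: (measurableT_comp (f := k)).
  - by move=> x _; rewrite lee_fin.
rewrite [leLHS](_ : _ = \int[mu]_x (k (T' x))%:E); last first.
  by apply: eq_measure_integral => A mA _; exact: muT.
rewrite [leRHS]integral_mkcond; apply: le_integral_lower => x _; first by rewrite lee_fin.
apply: le_trans (kf _) _; rewrite /patch T'T.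
case: ifPn => [/set_mem/= |_].
  by rewrite T'T => Dx; rewrite mem_set.
by case: ifP.
Qed.

Lemma integral_shift_le (c : R) D f : (forall x, 0 <= f x) ->
  \int[mu]_(x in [set x | D (x + c)%R]) f (x + c)%R <= \int[mu]_(x in D) f x.
Proof.
move=> f0; apply: (@integral_isometry_le (fun x => x + c)%R (fun x => x - c)%R) => //.
- exact: measurable_funD.
- exact: measurable_funB.
- exact: addrK.
- exact: subrK.
- move=> a b; rewrite (_ : _ @^-1` _ = `](a - c)%R, (b - c)%R]%classic).
    rewrite !lebesgue_measure_itv/= !lte_fin ltrD2r.
    by case: ifP => // _; rewrite -!EFinB; congr EFin; ring.
  by apply/seteqP; split => x /=; rewrite !in_itv/= ltrBlDr lerBrDr.
Qed.

Lemma integral_reflect_le (c : R) D f : (forall x, 0 <= f x) ->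
  \int[mu]_(x in [set x | D (c - x)%R]) f (c - x)%R <= \int[mu]_(x in D) f x.
Proof.
move=> f0; apply: (@integral_isometry_le (fun x => c - x)%R (fun x => c - x)%R) => //.
- exact: measurable_funB.
- exact: measurable_funB.
- by move=> x; rewrite subKr.
- by move=> x; rewrite subKr.
- move=> a b; rewrite (_ : _ @^-1` _ = `[(c - b)%R, (c - a)%R[%classic).
    rewrite !lebesgue_measure_itv/= !lte_fin ltrD2l ltrN2.
    by case: ifP => // _; rewrite -!EFinB; congr EFin; ring.
  by apply/seteqP; split => x /=; rewrite !in_itv/= => /andP[? ?]; apply/andP; split; lra.
Qed.

End lower_integral.

(** * Absolutely continuous functions have densities *)

Section density.
Context (R : realType).
Notation mu := (@lebesgue_measure R).
Implicit Types (u v f : R -> R) (a b : R).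

(** Absolute continuity without reference to an interval. Functions on [[a, b]]
    are extended by constants to fit it, which removes end-point cases from the
    differentiation arguments. *)
Definition ac_on_line (u : R -> R) : Prop :=
  forall e : R, 0 < e -> exists2 del : R, 0 < del &
    forall (n : nat) (l r : 'I_n -> R), (forall i, l i <= r i) ->
      trivIset [set: 'I_n] (fun i => `]l i, r i[%classic) ->
      \sum_(i < n) (r i - l i) < del ->
      \sum_(i < n) `|u (r i) - u (l i)| < e.

Lemma ac_on_line_continuous u : ac_on_line u -> continuous u.
Proof.
move=> gu x; apply/cvgrPdist_lt => e e0.
have [del del0 H] := gu e e0.
near=> t.
have H1 (s t' : R) : s <= t' -> t' - s < del -> `|u t' - u s| < e.
  move=> st sd.
  have := H 1%N (fun=> s) (fun=> t') (fun=> st).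
  rewrite !big_ord1; apply => //.
  by move=> i j _ _ _; rewrite (ord1 i) (ord1 j).
have : `|x - t| < del by near: t; apply: cvgr_dist_lt.
have [xt|tx] := leP x t.
  by rewrite distrC (distrC (u x)) ger0_norm ?subr_ge0// => ?; apply: H1.
by rewrite gtr0_norm ?subr_gt0// => ?; apply: H1 => //; exact: ltW.
Unshelve. all: by end_near. Qed.

(** Stieltjes measures are given on half-open intervals, absolute continuity speaks
    of open ones: an open interval of finite length is squeezed between the two. *)
Lemma interval_finite_measure (I : set R) : open I -> is_interval I ->
  (mu I < +oo)%E -> exists l r : R,
    [/\ l <= r, `]l, r[ `<=` I & I `<=` `]l, r]].
Proof.
move=> oI iI muI.
have IE : [set` Rhull I] = I by apply: RhullK; rewrite inE.
have bnd l r : l <= r -> `]l, r[ `<=` I -> I `<=` `[l, r] -> exists l r : R,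
    [/\ l <= r, `]l, r[ `<=` I & I `<=` `]l, r]].
  move=> lr lrI Ilr; exists l, r; split => // x Ix.
  have /= := Ilr _ Ix; rewrite !in_itv/= le_eqVlt => /andP[/orP[/eqP lx|->->//] xr].
  have /nbhs_ballP[e /= e0 He] : nbhs x I by exact: open_nbhs_nbhs.
  have /Ilr/= : I (x - e / 2).
    by apply: He; rewrite /ball/= opprB addrC subrK gtr0_norm; lra.
  rewrite in_itv/= => /andP[+ _]; lra.
have [->|I0] := eqVneq I set0.
  by exists 0, 0; split => //; rewrite set_itvoo0.
have [x0 Ix0] : I !=set0 by exact/set0P.
move: (Rhull I) IE => i IE.
move: muI Ix0; rewrite -IE lebesgue_measure_itv.
case: i IE => -[bl l|[]] [br r|[]] IE //=; rewrite ?in_itv/= ?andbF//.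
rewrite lte_fin => _ lx0r.
have lr : l <= r by move: lx0r; case: (bl) (br) => -[] /=; lra.
rewrite IE; apply: (bnd l r lr); rewrite -IE => x /=; rewrite !in_itv/=.
  by case: (bl) (br) => -[] /=; lra.
by case: (bl) (br) => -[] /=; lra.
- by rewrite ltry.
- by rewrite ltNyr.
Qed.

Lemma stieltjes_ocitv (U : cumulative R R) (s t : R) : s <= t ->
  lebesgue_stieltjes_measure U `]s, t]%classic = (U t - U s)%:E.
Proof.
move=> st; rewrite /lebesgue_stieltjes_measure /measure_extension.
rewrite measurable_mu_extE/=; last exact: is_ocitv.
by rewrite wlength_itv_bnd.
Qed.

Section absolutely_continuous_measure.
Variables (U : cumulative R R) (a b : R).
Hypotheses (gU : ac_on_line U) (Ua : forall t, t <= a -> U t = U a)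
  (Ub : forall t, b <= t -> U t = U b).

Let nu := lebesgue_stieltjes_measure U.

Lemma stieltjes_setT_lty : (nu [set: R] < +oo)%E.
Proof.
have -> : [set: R] = \bigcup_n `](- n%:R : R), n%:R]%classic.
  by rewrite (bigcup_itvT false false).
have : (nu \o (fun n : nat => `](- n%:R : R), n%:R]%classic)) n @[n --> \oo]
    --> nu (\bigcup_n `](- n%:R : R), n%:R]%classic).
  apply: nondecreasing_cvg_mu => //; first exact: bigcup_measurable.
  by move=> *; apply/subsetPset/subset_itv; rewrite leBSide/= ?lerN2 ler_nat.
move=> cn; apply: (@le_lt_trans _ _ (U b - U a)%:E); last exact: ltry.
rewrite -(cvg_lim _ cn)//; apply: lime_le; first by apply/cvg_ex; eexists; exact: cn.
apply: nearW => n /=; rewrite /nu stieltjes_ocitv ?ge0_cp// lee_fin.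
have nd := @cumulative_is_nondecreasing _ _ _ U.
apply: lerB.
  have [nb|/ltW/Ub->//] := leP n%:R b; exact: nd.
have [na|/ltW na] := leP (- n%:R) a; last exact: nd.
by rewrite Ua.
Qed.

(** A null set is covered by an open set of small Lebesgue measure, which is a
    countable disjoint union of open intervals; absolute continuity bounds the
    Stieltjes measure of every finite part of that union. *)
Lemma stieltjes_dominated : nu `<< mu.
Proof.
apply/null_content_dominatesP => A mA muA0; apply/eqP.
rewrite eq_le measure_ge0 andbT.
apply/lee_addgt0Pr => e e0; rewrite add0e.
have [del del0 H] := gU e0.
have [V [oV AV muV]] : exists V : set R, [/\ open V, A `<=` V & (mu (V `\` A) < del%:E)%E].
  by apply: lebesgue_regularity_outer => //; rewrite muA0.
have mV : @measurable _ (measurableTypeR R) V by exact: open_measurable.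
have muVd : (mu V < del%:E)%E.
  apply: le_lt_trans muV; rewrite -[leRHS]adde0 -muA0.
  rewrite -{1}(setDUK AV) setUC; apply: le_trans (measureU2 _ _ _) _ => //.
  exact: measurableD.
pose I := open_disjoint_itv oV.
have mI i : @measurable _ (measurableTypeR R) (I i) by apply: open_measurable; exact: open_disjoint_itv_open.
have tI : trivIset [set: nat] I by exact: open_disjoint_itv_trivIset.
have VE : V = \bigcup_i I i by exact: open_disjoint_itv_bigcup.
have muIV n : (\sum_(0 <= i < n) mu (I i) <= mu V)%E.
  rewrite VE measure_bigcup// .
  under eq_eseriesl do rewrite in_setT.
  exact: nneseries_lim_ge.
have lrI i : exists lr : R * R, [/\ lr.1 <= lr.2, `]lr.1, lr.2[ `<=` I i & I i `<=` `]lr.1, lr.2] ].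
  have [|||l [r [lr lrI Ilr]]] := @interval_finite_measure (I i).
  - exact: open_disjoint_itv_open.
  - exact: open_disjoint_itv_is_interval.
  - apply: (@le_lt_trans _ _ (mu V)).
      apply: le_measure; rewrite ?inE// VE => x Ix; by exists i.
    exact: lt_trans muVd (ltry _).
  by exists (l, r).
have [lr lrP] := choice lrI.
apply: (@le_trans _ _ (nu V)); first by rewrite le_measure ?inE.
rewrite VE [nu _](measure_bigcup nu setT I)//.
under eq_eseriesl do rewrite in_setT.
apply: lime_le; first exact: is_cvg_nneseries.
apply: nearW => n.
apply: (@le_trans _ _ (\sum_(i < n) `|U (lr i).2 - U (lr i).1|)%:E).
  rewrite big_mkord -sumEFin; apply: lee_sum => i _.
  have [h1 h2 h3] := lrP i.
  apply: (@le_trans _ _ (nu `](lr i).1, (lr i).2]%classic)).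
    by rewrite le_measure ?inE.
  by rewrite /nu stieltjes_ocitv// lee_fin ler_norm.
rewrite lee_fin ltW//.
apply: (H n (fun i => (lr i).1) (fun i => (lr i).2)).
- by move=> i; have [] := lrP i.
- move=> i j _ _ [x [xi xj]]; apply: val_inj; apply: tI => //; exists x; split.
    by have [_ + _] := lrP i; apply.
  by have [_ + _] := lrP j; apply.
- rewrite -lte_fin; apply: le_lt_trans muVd; apply: le_trans (muIV n).
  rewrite big_mkord -sumEFin; apply: lee_sum => i _.
  have [h1 h2 h3] := lrP i.
  apply: (@le_trans _ _ (mu `](lr i).1, (lr i).2[%classic)).
    rewrite lebesgue_measure_itv/= lte_fin; case: ltP => h //.
    by rewrite lee_fin subr_le0.
  by rewrite le_measure ?inE.
Qed.

Let finnu : fin_num_fun nu.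
Proof.
move=> A mA; rewrite ge0_fin_numE ?measure_ge0//.
by apply: le_lt_trans stieltjes_setT_lty; rewrite le_measure ?inE.
Qed.

HB.instance Definition _ := Measure.on nu.
HB.instance Definition _ := Measure_isFinite.Build _ _ _ nu finnu.

Lemma stieltjes_density : exists f : R -> R, [/\ forall x, 0 <= f x,
  mu.-integrable [set: R] (EFin \o f) &
  forall s t, s <= t -> (U t - U s)%:E = (\int[mu]_(x in `]s, t]) (f x)%:E)%E].
Proof.
have [g [g0 gfin ig gE]] := @radon_nikodym_sigma_finite _ _ _ mu nu stieltjes_dominated.
exists (fine \o g); split.
- by move=> x /=; rewrite fine_ge0.
- by apply: eq_integrable ig => // x _ /=; rewrite fineK.
- move=> s t st; rewrite -stieltjes_ocitv// [LHS]gE//.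
  by apply: eq_integral => x _ /=; rewrite fineK.
Qed.

End absolutely_continuous_measure.

End density.

(** * Length and absolute continuity of paths *)

Section punctured.
Context (R : realType).
Implicit Types (a b t : R).

(** At interior points the limit in [metric_speed] is an ordinary two-sided one. *)
Lemma within_dnbhs a b t : a < t -> t < b -> within `[a, b]%classic t^' = t^'.
Proof.
move=> at_ tb.
have ab' : t^' `[a, b]%classic.
  exists (Num.min (t - a) (b - t)); rewrite /= ?lt_min ?subr_gt0 ?at_ ?tb//.
  move=> x /=; rewrite lt_min => /andP[]; rewrite !ltr_distlC in_itv/=.
  by move=> /andP[? ?] /andP[? ?] _; apply/andP; split; lra.
apply/seteqP; split => A HA.
  by apply: (@filterS2 R t^' _ _ _ A (fun x h1 h2 => h1 h2) HA ab').
by apply: (@filterS R t^' _ _ _ (fun x h1 _ => h1) HA).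
Qed.

End punctured.

Section path_length.
Context (R : realType) (Z : Type) (d : Z -> Z -> R).
Hypotheses (dxx : forall x, d x x = 0) (dsym : forall x y, d x y = d y x)
  (dtri : forall x y z, d x z <= d x y + d y z).
Implicit Types (a b s t : R) (g : R -> Z) (v : R -> R).

Lemma pdist_ge0 x y : 0 <= d x y.
Proof. by have := dtri x y x; rewrite dxx (dsym y x); lra. Qed.

Local Notation polygon g := (chain_sum (fun s t => d (g s) (g t))).

Lemma polygonE g a b (s : seq R) :
  \sum_(0 <= i < size s) d (g (nth b (a :: s) i)) (g (nth b (a :: s) i.+1)) =
  polygon g a s.
Proof. exact: (chain_sumE (fun s t => d (g s) (g t))). Qed.

(** Absolute continuity of a path is used in this form: distances are dominated by
    the increments of a real absolutely continuous function. Unlike the length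
    function, such a [v] is easily produced for a concatenation or a reversal. *)
Definition controlled a b g v : Prop :=
  forall s t, a <= s -> s <= t -> t <= b -> d (g s) (g t) <= v t - v s.

Lemma polygon_controlled a b g v p : controlled a b g v ->
  path <%O a p -> last a p <= b -> polygon g a p <= v (last a p) - v a.
Proof.
elim: p a => [|x p IH] a gv /=; first by rewrite subrr.
move=> /andP[ax xp] pb.
have xl : x <= last x p by apply: (@itv_partition_le _ _ _ _ p); split.
have := gv a x (lexx _) (ltW ax) (le_trans xl pb).
have : controlled x b g v by move=> s t xs; apply: gv; apply: le_trans xs; exact: ltW.
by move=> /IH /(_ xp pb); lra.
Qed.

Lemma path_length_controlled a b g v : controlled a b g v ->
  (path_length d a b g <= (v b - v a)%:E)%E.
Proof.
move=> gv; apply: ge_ereal_sup => _ [p [pp /eqP pb] <-].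
rewrite lee_fin polygonE; have := polygon_controlled gv pp.
by rewrite pb; apply.
Qed.

Lemma path_length_ge0 a b g : a <= b -> (0%:E <= path_length d a b g)%E.
Proof.
rewrite le_eqVlt => /predU1P[->|ab].
  by apply: ereal_sup_ubound; exists [::]; [split => //=|rewrite big_nil].
apply: (@le_trans _ _ (d (g a) (g b))%:E); first by rewrite lee_fin pdist_ge0.
apply: ereal_sup_ubound; exists [:: b]; first exact: itv_partition1.
by rewrite polygonE/= addr0.
Qed.

Lemma path_length_extend a s t g : a <= s -> s < t ->
  (path_length d a s g + (d (g s) (g t))%:E <= path_length d a t g)%E.
Proof.
move=> as_ st; rewrite -leeBrDr//; apply: ge_ereal_sup => _ [p [pp /eqP ps] <-].
rewrite leeBrDr// -EFinD; apply: ereal_sup_ubound; exists (rcons p t).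
  by split; rewrite ?last_rcons// rcons_path pp/= ps.
by rewrite !polygonE -cats1 chain_sum_cat ps /= addr0.
Qed.

Lemma path_length_mono a s t g : a <= s -> s <= t ->
  (path_length d a s g <= path_length d a t g)%E.
Proof.
move=> as_; rewrite le_eqVlt => /predU1P[->//|st].
apply: le_trans (path_length_extend g as_ st).
by rewrite leeDl// lee_fin pdist_ge0.
Qed.

Lemma controlled_path_length a b g : (path_length d a b g < +oo)%E ->
  controlled a b g (fun t => fine (path_length d a t g)).
Proof.
move=> lfin s t as_ st tb.
have fin u : a <= u -> u <= b -> path_length d a u g \is a fin_num.
  move=> au ub; rewrite ge0_fin_numE ?path_length_ge0//.
  exact: le_lt_trans (path_length_mono _ au ub) lfin.
have [->|nst] := eqVneq s t; first by rewrite subrr dxx.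
have st' : s < t by rewrite lt_neqAle nst.
have := path_length_extend g as_ st'.
have sb := le_trans st tb; have at_ := le_trans as_ st.
by rewrite -(fineK (fin _ as_ sb)) -(fineK (fin _ at_ tb)) -EFinD lee_fin; lra.
Qed.

(** Refining a partition at [s] costs nothing by the triangle inequality; the part
    after [s] is bounded by the increment of [v]. *)
Lemma polygon_split a s t g v p : controlled a t g v -> a <= s -> s <= t ->
  itv_partition a t p -> exists2 q, itv_partition a s q &
    polygon g a p <= polygon g a q + (v t - v s).
Proof.
elim: p a => [|x p IH] a gv as_ st [/= pp /eqP pt].
  have ast : a = s by apply/eqP; rewrite eq_le as_ pt.
  by subst; exists [::]; [split=> //=|rewrite /= subrr addr0].
move: pp => /andP[ax xp].
have xt : x <= t by apply: (@itv_partition_le _ _ _ _ p); split => //; rewrite pt.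
have gvx : controlled x t g v.
  by move=> u w xu; apply: gv; apply: le_trans xu; exact: ltW.
have [xs|sx] := leP x s.
  have [|q [qp ql] Hq] := IH x gvx xs st; first by split => //; apply/eqP.
  by exists (x :: q); [split; rewrite //= ax|rewrite /=; lra].
have Hp := polygon_controlled gvx xp.
rewrite pt in Hp; have {}Hp := Hp (lexx _).
have Hx := gv s x as_ (ltW sx) xt.
have := dtri (g a) (g s) (g x).
have [as'|sa] := ltP a s.
  by exists [:: s]; [exact: itv_partition1|rewrite /= addr0; lra].
have ast : a = s by apply/eqP; rewrite eq_le as_.
by subst; exists [::]; [split=> //=|rewrite /=; lra].
Qed.

Lemma path_length_split a s t g v : controlled a t g v -> a <= s -> s <= t ->
  (path_length d a t g <= path_length d a s g + (v t - v s)%:E)%E.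
Proof.
move=> gv as_ st; apply: ge_ereal_sup => _ [p pp <-].
have [q qp Hq] := polygon_split gv as_ st pp.
rewrite polygonE; apply: (@le_trans _ _ (polygon g a q + (v t - v s))%:E).
  by rewrite lee_fin.
rewrite EFinD leeD2r//; apply: ereal_sup_ubound; exists q => //.
by rewrite polygonE.
Qed.

Lemma abs_continuous1 a b v (e : R) : abs_continuous a b v -> 0 < e ->
  exists2 del, 0 < del & forall s t, a <= s -> s <= t -> t <= b ->
    t - s < del -> `|v t - v s| < e.
Proof.
move=> av e0; have [del del0 H] := av e e0; exists del => // s t as_ st tb std.
have := H 1%N (fun=> s) (fun=> t) (fun=> And3 as_ st tb).
rewrite !big_ord1; apply => // i j _ _ _.
by rewrite (ord1 i) (ord1 j).
Qed.

(** One direction takes the length function for [v]. In the other, additivity of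
    length shows that the length function grows no faster than [v]. *)
Lemma ac_pathP a b g : abs_continuous_path d a b g <->
  a <= b /\ exists v, abs_continuous a b v /\ controlled a b g v.
Proof.
split=> [[[[ab _] lfin] ac]|[ab [v [av gv]]]].
  split=> //; exists (fun t => fine (path_length d a t g)); split => //.
  exact: controlled_path_length.
have lfin : (path_length d a b g < +oo)%E.
  by apply: le_lt_trans (path_length_controlled gv) _; rewrite ltry.
split; [split=> //; split=> //|].
  move=> t; rewrite in_itv/= => /andP[at_ tb].
  apply/cvgrPdist_lt => e e0; rewrite near_withinE.
  have [del del0 H] := abs_continuous1 av e0.
  apply/nbhs_ballP; exists del => //= u; rewrite /ball/= in_itv/= => tu /andP[au ub].
  rewrite sub0r normrN ger0_norm ?pdist_ge0//.
  have [ut|/ltW tu'] := leP u t.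
    apply: le_lt_trans (gv _ _ au ut tb) _; apply: le_lt_trans (ler_norm _) _.
    by apply: H => //; move: tu; rewrite ger0_norm ?subr_ge0.
  rewrite dsym; apply: le_lt_trans (gv _ _ at_ tu' ub) _; apply: le_lt_trans (ler_norm _) _.
  by apply: H => //; move: tu; rewrite distrC ger0_norm ?subr_ge0.
move=> e e0; have [del del0 H] := av e e0; exists del => // n l r lr tr sd.
apply: le_lt_trans (H n l r lr tr sd); apply: ler_sum => i _.
have [al lri rb] := lr i.
have cl := controlled_path_length lfin.
have := path_length_split (g := g) (v := v) (a := a) (s := l i) (t := r i).
have gvr : controlled a (r i) g v.
  by move=> s t as_ st tr'; apply: gv => //; exact: le_trans rb.
move=> /(_ gvr al lri).
have fin u : a <= u -> u <= b -> path_length d a u g \is a fin_num.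
  move=> au ub; rewrite ge0_fin_numE ?path_length_ge0//.
  exact: le_lt_trans (path_length_mono _ au ub) lfin.
have lb := le_trans lri rb; have ar := le_trans al lri.
rewrite -(fineK (fin _ al lb)) -(fineK (fin _ ar rb)) -EFinD lee_fin => hs.
have := cl _ _ al lri rb; have := pdist_ge0 (g (l i)) (g (r i)) => h1 h2.
rewrite ger0_norm; last lra.
by apply: le_trans (ler_norm _); lra.
Qed.

(** Precomposing with [clamp a b] extends a path on [[a, b]] by constants. *)
Definition clamp a b t : R := Num.max a (Num.min b t).

Lemma clamp_ge a b t : a <= clamp a b t.
Proof. by rewrite /clamp le_max lexx. Qed.

Lemma clamp_le a b t : a <= b -> clamp a b t <= b.
Proof. by move=> ab; rewrite /clamp ge_max ab ge_min lexx. Qed.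

Lemma clamp_id a b t : a <= t -> t <= b -> clamp a b t = t.
Proof. by move=> at_ tb; rewrite /clamp (min_r tb) (max_r at_). Qed.

Lemma clamp_l a b t : a <= b -> t <= a -> clamp a b t = a.
Proof. by move=> ab ta; rewrite /clamp (min_r (le_trans ta ab)) max_l. Qed.

Lemma clamp_r a b t : a <= b -> b <= t -> clamp a b t = b.
Proof. by move=> ab bt; rewrite /clamp (min_l bt) max_r. Qed.

Lemma clamp_mono a b s t : s <= t -> clamp a b s <= clamp a b t.
Proof.
by move=> st; rewrite /clamp ge_max !le_max lexx/=; apply/orP; right; rewrite le_min !ge_min lexx st orbT.
Qed.

Lemma clamp_lip a b s t : a <= b -> s <= t -> clamp a b t - clamp a b s <= t - s.
Proof.
move=> ab st; rewrite /clamp.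
by case: (leP b s); case: (leP b t); case: (leP a b); case: (leP a s); case: (leP a t); lra.
Qed.

Lemma clamp_in a b s t x : a <= b -> clamp a b s < x -> x < clamp a b t -> s < x /\ x < t.
Proof.
move=> ab; rewrite /clamp.
by case: (leP b s); case: (leP b t); case: (leP a s); case: (leP a t); rewrite ?(max_r ab); split; lra.
Qed.

Lemma ac_on_line_clamp a b v : a <= b -> abs_continuous a b v -> ac_on_line (v \o clamp a b).
Proof.
move=> ab av e e0; have [del del0 H] := av e e0; exists del => // n l r lr tr sd.
apply: (H n (fun i => clamp a b (l i)) (fun i => clamp a b (r i))).
- by move=> i; split; [exact: clamp_ge|exact: clamp_mono|exact: clamp_le].
- move=> i j _ _ [x /= []]; rewrite !in_itv/= => /andP[h1 h2] /andP[h3 h4].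
  have [? ?] := clamp_in ab h1 h2; have [? ?] := clamp_in ab h3 h4.
  by apply: tr => //; exists x; split; rewrite /= in_itv/=; apply/andP.
- by apply: le_lt_trans sd; apply: ler_sum => i _; exact: clamp_lip.
Qed.

Lemma metric_speedE a b g t m : a < t -> t < b ->
  (forall e : R, 0 < e -> exists2 del : R, 0 < del &
    forall u : R, u != t -> `|u - t| < del -> `|d (g u) (g t) / `|u - t| - m| < e) ->
  metric_speed d a b g t = m.
Proof.
move=> at_ tb H.
have wE := within_dnbhs at_ tb.
apply/cvg_lim => //; first by rewrite wE; exact: Proper_dnbhs_numFieldType.
rewrite wE; apply/cvgrPdist_lt => e /H[del del0 {}H].
exists del => //= u ut utd; rewrite distrC; apply: H => //.
by rewrite distrC.
Qed.

End path_length.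

(** * Existence of the metric speed *)

Section primitive.
Context (R : realType).
Notation mu := (@lebesgue_measure R).
Implicit Types (f F u v : R -> R).

Definition primitive f (x : R) : R := \int[mu]_(t in `]-oo, x]) f t.

Lemma primitive_diff f s t : mu.-integrable [set: R] (EFin \o f) -> s <= t ->
  primitive f t - primitive f s = \int[mu]_(x in `]s, t]) f x.
Proof.
move=> fi st; rewrite /primitive Rintegral_itvB//.
exact: integrableS fi.
Qed.

Lemma primitive_diffE f s t : mu.-integrable [set: R] (EFin \o f) -> s <= t ->
  (primitive f t - primitive f s)%:E = (\int[mu]_(x in `]s, t]) (f x)%:E)%E.
Proof.
move=> fi st; rewrite primitive_diff// /Rintegral fineK//.
by apply: integrable_fin_num => //; exact: integrableS fi.
Qed.

Definition slope_cvg F (t l : R) : Prop :=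
  forall e : R, 0 < e -> exists2 del : R, 0 < del &
    forall u : R, u != t -> `|u - t| < del -> `|(F u - F t) / (u - t) - l| < e.

Lemma primitive_slope f : mu.-integrable [set: R] (EFin \o f) ->
  {ae mu, forall t, slope_cvg (primitive f) t (f t)}.
Proof.
move=> fi.
have li : locally_integrable [set: R] f.
  by apply: open_integrable_locally => //; exact: openT.
have fiy (y : R) : mu.-integrable `]-oo, y] (EFin \o f) by exact: integrableS fi.
have H := FTC1Ny fiy li.
apply: filterS H; first exact: (ae_filter_ringOfSetsType mu).
move=> t [/= dt Dt] e e0.
rewrite -/(primitive f) in dt Dt.
have : h^-1 *: ((primitive f \o shift t) (h *: 1) - primitive f t) @[h --> (0:R)^'] --> f t.
  by rewrite -Dt derive1E; exact: dt.
move=> /cvgrPdist_lt /(_ e e0); rewrite near_withinE => /nbhs_ballP[del /= del0 H].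
exists del => // u ut utd.
have := H (u - t).
rewrite /ball/= sub0r normrN subr_eq0 => /(_ utd ut).
by rewrite distrC [_ *: 1]mulr1 subrK [_ *: _]mulrC.
Qed.

(** Both [v] and [v + phi] are nondecreasing and absolutely continuous, hence have
    densities; subtract. *)
Lemma controlled_density (v phi : R -> R) (a b : R) : ac_on_line v ->
  (forall t, t <= a -> v t = v a) -> (forall t, b <= t -> v t = v b) ->
  (forall s t, s <= t -> `|phi t - phi s| <= v t - v s) ->
  exists2 f, mu.-integrable [set: R] (EFin \o f) &
    forall s t, s <= t -> phi t - phi s = primitive f t - primitive f s.
Proof.
move=> gv va vb pv.
have main (U : R -> R) : {homo U : x y / x <= y} ->
   (forall s t, s <= t -> `|U t - U s| <= 2 * (v t - v s)) ->
   exists2 f, mu.-integrable [set: R] (EFin \o f) &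
    forall s t, s <= t -> U t - U s = primitive f t - primitive f s.
  move=> nU UV.
  have gU : ac_on_line U.
    move=> e e0; have [|del del0 H] := gv (e / 2); first lra.
    exists del => // n l r lr tr /H => /(_ lr tr) {}H.
    apply: (@le_lt_trans _ _ (2 * \sum_(i < n) `|v (r i) - v (l i)|)); last lra.
    rewrite mulr_sumr; apply: ler_sum => i _.
    apply: le_trans (UV _ _ (lr i)) _; rewrite ler_pM2l//; exact: ler_norm.
  have cU : forall x, U @ at_right x --> U x.
    by apply: right_continuousW; exact: ac_on_line_continuous.
  pose m := isCumulative.Build R _ R U nU cU.
  pose UC : cumulative R R := HB.pack U m.
  have Ua t : t <= a -> U t = U a.
    move=> ta; have := UV _ _ ta; rewrite (va _ ta) subrr mulr0 normr_le0 subr_eq0.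
    by move/eqP.
  have Ub t : b <= t -> U t = U b.
    move=> ta; have := UV _ _ ta; rewrite (vb _ ta) subrr mulr0 normr_le0 subr_eq0.
    by move/eqP.
  have [f [f0 fi fE]] := @stieltjes_density R UC a b gU Ua Ub.
  exists f => // s t st; apply: EFin_inj; rewrite primitive_diffE//; exact: fE.
have nv s t : s <= t -> v s <= v t.
  by move=> st; rewrite -subr_ge0; apply: le_trans (pv _ _ st).
have [f fi fE] : exists2 f, mu.-integrable [set: R] (EFin \o f) &
    forall s t, s <= t -> (v t + phi t) - (v s + phi s) = primitive f t - primitive f s.
  apply: (main (fun t => v t + phi t)) => s t st; have := pv _ _ st; rewrite !ler_norml; lra.
have [g gi gE] : exists2 f, mu.-integrable [set: R] (EFin \o f) &
    forall s t, s <= t -> v t - v s = primitive f t - primitive f s.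
  apply: (main v) => // s t st; rewrite ger0_norm ?subr_ge0 ?nv//.
  by have := nv _ _ st; lra.
exists (fun x => f x - g x).
  have := integrableB measurableT fi gi.
  by apply: eq_integrable => // x _ /=.
move=> s t st; rewrite primitive_diff//; last first.
  have := integrableB measurableT fi gi.
  by apply: eq_integrable => // x _ /=.
rewrite RintegralB//; [|exact: integrableS fi|exact: integrableS gi].
by rewrite -!primitive_diff// -gE// -fE//; lra.
Qed.

End primitive.

Section metric_speed.
Context (R : realType) (Z : Type) (d : Z -> Z -> R).
Notation mu := (@lebesgue_measure R).
Hypotheses (dxx : forall x, d x x = 0) (dsym : forall x y, d x y = d y x)
  (dtri : forall x y z, d x z <= d x y + d y z).

Let d_ge0 x y : 0 <= d x y.
Proof. by have := dtri x y x; rewrite dxx (dsym y x); lra. Qed.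

Let dtri' x y z : `|d x z - d y z| <= d x y.
Proof. by have := dtri x y z; have := dtri y x z; rewrite (dsym y x) ler_norml; lra. Qed.

(** For each point [w] of a countable dense subset of the path, [d (g _) w] is
    dominated by [v], hence is a primitive. Let [m] be the supremum of the
    absolute values of these densities. The difference quotient of [g] is at
    least that of every [d (g _) w], so its lower limit is at least [m]. Since
    [d (g s) (g t)] is the supremum of the increments of the [d (g _) w], it is
    at most the integral of [m] over [[s, t]], and Lebesgue differentiation
    bounds the upper limit by [m]. *)
Lemma metric_speed_ae (v : R -> R) (g : R -> Z) (a b : R) : ac_on_line v ->
  (forall t, t <= a -> v t = v a) -> (forall t, b <= t -> v t = v b) ->
  (forall s t, s <= t -> d (g s) (g t) <= v t - v s) ->
  exists m : R -> R, [/\ forall t, 0 <= m t,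
    mu.-integrable [set: R] (EFin \o m),
    forall s t, s <= t -> d (g s) (g t) <= primitive m t - primitive m s &
    {ae mu, forall t, forall e : R, 0 < e -> exists2 del : R, 0 < del &
      forall u : R, u != t -> `|u - t| < del -> `|d (g u) (g t) / `|u - t| - m t| < e}].
Proof.
move=> gv va vb gV.
pose q (n : nat) : R := ratr (odflt 0%Q (unpickle n)).
pose phi n t := d (g t) (g (q n)).
have pV n s t : s <= t -> `|phi n t - phi n s| <= v t - v s.
  by move=> st; apply: le_trans (dtri' _ _ _) _; rewrite dsym; exact: gV.
have nv s t : s <= t -> v s <= v t.
  by move=> st; rewrite -subr_ge0; apply: le_trans (gV _ _ st).
have /choice[f fP] n : exists f, mu.-integrable [set: R] (EFin \o f) /\
    forall s t, s <= t -> phi n t - phi n s = primitive f t - primitive f s.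
  by have [f] := @controlled_density R v (phi n) a b gv va vb (pV n); exists f.
have [fv fvi fvE] : exists2 f, mu.-integrable [set: R] (EFin \o f) &
    forall s t, s <= t -> v t - v s = primitive f t - primitive f s.
  apply: (@controlled_density R v v a b) => // s t st.
  by rewrite ger0_norm ?subr_ge0 ?nv.
have slope_eq (F G : R -> R) t l : (forall s t, s <= t -> F t - F s = G t - G s) ->
    slope_cvg G t l -> slope_cvg F t l.
  move=> FG H e /H[del del0 {}H]; exists del => // u ut utd.
  have -> : F u - F t = G u - G t; last exact: H.
  by have [/FG//|/ltW/FG] := leP t u; lra.
(* capping by the density of [v] makes the supremum finite everywhere and
   integrable; almost everywhere it changes nothing *)
pose h n t := Num.min `|f n t| `|fv t|.
have hfv n t : h n t <= `|fv t| by rewrite /h ge_min lexx orbT.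
have h_ge0 n t : 0 <= h n t by rewrite /h le_min !normr_ge0.
have hub t : has_ubound (range (h ^~ t)).
  by exists `|fv t| => _ [n _ <-].
have mfun (k : R -> R) : mu.-integrable [set: R] (EFin \o k) -> measurable_fun [set: R] k.
  by move=> /integrableP[/measurable_EFinP].
pose m t := sups (h ^~ t) 0%N.
have hm n t : h n t <= m t.
  by apply: ub_le_sup; [exact: has_ubound_sdrop|exists n].
have m_ge0 t : 0 <= m t by apply: le_trans (hm 0%N t).
have sdn t : sdrop (h ^~ t) 0%N !=set0 by exists (h 0%N t), 0%N.
have mfv t : m t <= `|fv t|.
  by apply: ge_sup; [exact: sdn|move=> _ [n _ <-]].
have mm : measurable_fun [set: R] m.
  apply: measurable_fun_sups => // n.
  apply: measurable_minr; apply: measurableT_comp => //; apply: mfun => //.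
  by have [] := fP n.
have mi : mu.-integrable [set: R] (EFin \o m).
  apply: (le_integrable measurableT _ _ fvi); first exact/measurable_EFinP.
  by move=> t _ /=; rewrite lee_fin ger0_norm.
have good : {ae mu, forall t, (forall n, slope_cvg (phi n) t (f n t)) /\
     slope_cvg v t (fv t) /\ slope_cvg (primitive m) t (m t)}.
  have : {ae mu, forall t, forall n, slope_cvg (phi n) t (f n t)}.
    change (mu.-negligible (~` [set t | forall n, slope_cvg (phi n) t (f n t)])).
    apply: (@negligibleS _ _ _ mu (\bigcup_n ~` [set t | slope_cvg (phi n) t (f n t)])).
      by move=> t /= /existsNP[n Hn]; exists n.
    apply: negligible_bigcup => n; have [fi fE] := fP n.
    have := primitive_slope fi; apply: filterS; first exact: (ae_filter_ringOfSetsType mu).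
    by move=> t; apply: slope_eq.
  have := primitive_slope mi; have := primitive_slope fvi.
  apply: filterS3; first exact: (ae_filter_ringOfSetsType mu).
  move=> t H1 H2 H3; split=> //; split=> //; exact: slope_eq H1.
have fnv : {ae mu, forall t, forall n, `|f n t| = h n t}.
  apply: filterS good; first exact: (ae_filter_ringOfSetsType mu).
  move=> t [H1 [H2 _]] n; rewrite /h min_l//.
  apply/ler_addgt0Pr => e e0.
  have e2 : 0 < e / 2 by lra.
  have [d1 d10 {}H1] := H1 n _ e2; have [d2 d20 {}H2] := H2 _ e2.
  (* derivatives are compared through one difference quotient *)
  pose u := t + Num.min d1 d2 / 2.
  have md1 : Num.min d1 d2 <= d1 by rewrite ge_min lexx.
  have md2 : Num.min d1 d2 <= d2 by rewrite ge_min lexx orbT.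
  have md0 : 0 < Num.min d1 d2 by rewrite lt_min d10.
  have u0 : 0 < u - t by rewrite /u; lra.
  have ut : u != t by rewrite -subr_eq0 gt_eqF.
  have [ud1 ud2] : `|u - t| < d1 /\ `|u - t| < d2.
    by rewrite (gtr0_norm u0) /u; split; lra.
  have {}H1 := H1 _ ut ud1; have {}H2 := H2 _ ut ud2.
  have : `|(phi n u - phi n t) / (u - t)| <= (v u - v t) / (u - t).
    rewrite normrM (gtr0_norm (x := (u - t)^-1)) ?invr_gt0//.
    by rewrite ler_pM2r ?invr_gt0// pV// -subr_ge0 ltW.
  move: H1 H2; set x := _ / (u - t); set y := (v u - v t) / (u - t) => H1 H2 xy.
  have := ler_normB x (x - f n t); have := ler_norm (y - fv t); have := ler_norm (fv t).
  rewrite subKr; lra.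
have gm s t : s <= t -> d (g s) (g t) <= primitive m t - primitive m s.
  move=> st; rewrite primitive_diff//.
  have key n : phi n t - phi n s <= \int[mu]_(x in `]s, t]) m x.
    have [fi fE] := fP n; rewrite fE// primitive_diff//.
    rewrite -lee_fin.
    apply: (@le_trans _ _ (\int[mu]_(x in `]s, t]) `|f n x|)%:E).
      rewrite lee_fin; apply: le_trans (ler_norm _) _; apply: le_normr_Rintegral => //.
      exact: integrableS fi.
    rewrite /Rintegral !fineK; last 2 first.
    + by apply: integrable_fin_num => //; exact: integrableS mi.
    + apply: integrable_fin_num => //; apply: integrableS (integrable_norm fi) => //.
    apply: ae_ge0_le_integral => //.
    + by apply/measurable_EFinP/measurable_funTS/measurableT_comp => //; exact: mfun.
    + by move=> x _; rewrite lee_fin.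
    + by apply/measurable_EFinP/measurable_funTS.
    + apply: (@filterS _ _ (ae_filter_ringOfSetsType mu) _ _ _ fnv).
      by move=> x Hx _; rewrite lee_fin Hx.
  (* distances from a dense point close to [g s] grow by almost [d (g s) (g t)] *)
  apply/ler_addgt0Pr => e e0.
  have cv : continuous v by exact: ac_on_line_continuous.
  have : \forall x \near s, `|v s - v x| < e / 2.
    by move: (cv s) => /cvgrPdist_lt; apply; lra.
  move=> /nbhs_ballP[del /= del0 Hd].
  have [|r [/Hd vr [c _ cr]]] := @dense_rat R (ball s del) _ (ball_open _ _).
    by exists s; exact: ballxx.
  have qr : q (pickle c) = r by rewrite /q pickleK.
  have sr : d (g s) (g r) < e / 2.
    have [h1|/ltW h1] := leP s r.
      by apply: le_lt_trans (gV _ _ h1) _; move: vr; rewrite ltr_norml; lra.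
    by rewrite dsym; apply: le_lt_trans (gV _ _ h1) _; move: vr; rewrite ltr_norml; lra.
  have := key (pickle c); rewrite /phi qr.
  by have := dtri (g s) (g r) (g t); rewrite (dsym (g r) (g t)); lra.
exists m; split => //.
  apply: (@filterS2 _ _ (ae_filter_ringOfSetsType mu) _ _ _ _ fnv good).
  move=> t fnh [H1 [_ H3]] e e0.
  have e2 : 0 < e / 2 by lra.
  have [d3 d30 {}H3] := H3 _ e0.
  have [_ [n _ <-] hn] : exists2 x, sdrop (h ^~ t) 0%N x & m t - e / 2 < x.
    apply: sup_adherent => //; split; [exact: sdn|exact: has_ubound_sdrop].
  have [d1 d10 {}H1] := H1 n _ e2.
  exists (Num.min d1 d3) => [|u ut]; first by rewrite lt_min d10.
  rewrite lt_min => /andP[ud1 ud3].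
  have {}H1 := H1 _ ut ud1; have {}H3 := H3 _ ut ud3.
  have ut0 : 0 < `|u - t| by rewrite normr_gt0 subr_eq0.
  have lo : `|(phi n u - phi n t) / (u - t)| <= d (g u) (g t) / `|u - t|.
    by rewrite normrM normfV ler_pM2r ?invr_gt0// dtri'.
  have hi : d (g u) (g t) / `|u - t| <= `|(primitive m u - primitive m t) / (u - t)|.
    rewrite normrM normfV ler_pM2r ?invr_gt0//.
    have [/gm h1|/ltW/gm h1] := leP t u; first by rewrite dsym (le_trans h1)// ler_norm.
    by rewrite distrC (le_trans h1)// ler_norm.
  move: lo hi H1 H3; rewrite -fnh in hn; set x := (phi n u - _) / _; set y := d _ _ / _; set z := (primitive m u - _) / _.
  move=> lo hi H1 H3.
  have := ler_normB x (x - f n t); rewrite subKr => H4.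
  have := ler_normD (z - m t) (m t); rewrite subrK (ger0_norm (m_ge0 t)) => H5.
  by rewrite ltr_norml; lra.
Qed.
End metric_speed.

(** * Concatenation and reversal of paths *)

Section speed.
Context (R : realType).
Implicit Types (a b s t : R).

(** The metric speed depends only on the germ of the path, up to an isometry of the
    parameter. *)
Lemma metric_speed_congr (Z : Type) (d : Z -> Z -> R) a b a' b' (g g' : R -> Z) t
    (T T' : R -> R) :
  a < t -> t < b -> a' < T t -> T t < b' ->
  (forall u w, `|T u - T w| = `|u - w|) -> cancel T T' -> cancel T' T ->
  (exists2 del : R, 0 < del & forall u, `|u - t| < del -> g u = g' (T u)) ->
  metric_speed d a b g t = metric_speed d a' b' g' (T t).
Proof.
move=> h1 h2 h3 h4 isoT TK T'K [del del0 gg'].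
rewrite /metric_speed !within_dnbhs//.
congr (lim _).
have gt0 : g t = g' (T t) by apply: gg'; rewrite subrr normr0.
apply/seteqP; split => A [e /= e0 HA].
  exists (Num.min e del) => /=; first by rewrite lt_min e0.
  move=> u /=; rewrite lt_min => /andP[ue ud] ut.
  have uT : `|T t - u| = `|t - T' u| by rewrite -{1}(T'K u) isoT.
  have := HA (T' u); rewrite /= -uT => /(_ ue).
  rewrite /= gt0 gg'; last by rewrite distrC -uT.
  rewrite T'K distrC -uT (distrC u); apply.
  by apply: contra_neq ut => <-; rewrite T'K.
exists (Num.min e del) => /=; first by rewrite lt_min e0.
move=> u /=; rewrite lt_min => /andP[ue ud] ut.
have := HA (T u); rewrite /= (isoT t u) (isoT u t) => /(_ ue).
rewrite /= gt0 gg'; last by rewrite distrC.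
by apply; apply: contra_neq ut => /(can_inj TK).
Qed.

End speed.

Section ac_operations.
Context (R : realType).
Implicit Types (a b c e s t : R) (v : R -> R).

Definition glue (Z : Type) b c (g1 g2 : R -> Z) t :=
  if t <= b then g1 t else g2 (t + (c - b)).

Lemma truncate_below a b l r : a <= b -> a <= l -> l <= r ->
  [/\ a <= Num.min l b, Num.min l b <= Num.min r b, Num.min r b <= b &
      Num.min r b - Num.min l b <= r - l].
Proof. by move=> ab al lr; split; case: (leP l b); case: (leP r b); lra. Qed.

Lemma truncate_above b c e l r : c <= e -> l <= r -> r <= b + (e - c) ->
  [/\ c <= Num.max l b + (c - b),
      Num.max l b + (c - b) <= Num.max r b + (c - b),
      Num.max r b + (c - b) <= e &
      Num.max r b + (c - b) - (Num.max l b + (c - b)) <= r - l].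
Proof. by move=> ce lr rb; split; case: (leP l b); case: (leP r b); lra. Qed.

Lemma truncate_below_sub b l r x :
  Num.min l b < x -> x < Num.min r b -> l < x < r.
Proof. by case: (leP l b); case: (leP r b); lra. Qed.

Lemma truncate_above_sub b k l r x :
  Num.max l b + k < x -> x < Num.max r b + k -> l < x - k < r.
Proof. by case: (leP l b); case: (leP r b); lra. Qed.

(** An interval that contains the junction is cut there; the pieces on either side
    of the junction form two disjoint families. *)
Lemma abs_continuous_glue a b c e v1 v2 : a <= b -> c <= e ->
  abs_continuous a b v1 -> abs_continuous c e v2 ->
  abs_continuous a (b + (e - c)) (glue b c v1 (fun t => v1 b + (v2 t - v2 c))).
Proof.
set v := glue _ _ _ _.
move=> ab ce a1 a2 ep ep0; have ep2 : 0 < ep / 2 by rewrite divr_gt0.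
have [d1 d10 H1] := a1 _ ep2; have [d2 d20 H2] := a2 _ ep2.
exists (Num.min d1 d2); first by rewrite lt_min d10.
move=> n l r lr tr; rewrite lt_min => /andP[sd1 sd2].
pose l1 i := Num.min (l i) b; pose r1 i := Num.min (r i) b.
pose l2 i := Num.max (l i) b + (c - b); pose r2 i := Num.max (r i) b + (c - b).
have {}H1 := H1 n l1 r1; have {}H2 := H2 n l2 r2.
have below i : [/\ a <= l1 i, l1 i <= r1 i, r1 i <= b & r1 i - l1 i <= r i - l i].
  by have [al lri _] := lr i; exact: truncate_below.
have above i : [/\ c <= l2 i, l2 i <= r2 i, r2 i <= e & r2 i - l2 i <= r i - l i].
  by have [_ lri rb] := lr i; exact: truncate_above.
have sumv : \sum_(i < n) `|v (r i) - v (l i)| <=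
   \sum_(i < n) `|v1 (r1 i) - v1 (l1 i)| + \sum_(i < n) `|v2 (r2 i) - v2 (l2 i)|.
  rewrite -big_split/=; apply: ler_sum => i _; rewrite /v /glue /r1 /l1 /r2 /l2.
  have [_ lri _] := lr i; have bcb : b + (c - b) = c by ring.
  have [lb|lb] := leP (l i) b; have [rb|rb] := leP (r i) b.
  - by rewrite lerDl.
  - rewrite bcb (_ : _ - v1 (l i) = (v1 b - v1 (l i)) + (v2 (r i + (c - b)) - v2 c)); last by ring.
    exact: ler_normD.
  - by have := lt_le_trans lb lri; rewrite ltNge rb.
  - by rewrite (_ : _ - _ = v2 (r i + (c - b)) - v2 (l i + (c - b))) ?lerDr//; ring.
apply: le_lt_trans sumv _; rewrite [ltRHS]splitr; apply: ltrD.
  apply: H1.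
  - by move=> i; have [? ? ? _] := below i.
  - move=> i j _ _ [x /= []]; rewrite !in_itv/= => /andP[x1 x2] /andP[x3 x4].
    by apply: tr => //; exists x; split; rewrite /= in_itv/=; [exact: truncate_below_sub x1 x2|exact: truncate_below_sub x3 x4].
  - by apply: le_lt_trans sd1; apply: ler_sum => i _; have [] := below i.
apply: H2.
- by move=> i; have [? ? ? _] := above i.
- move=> i j _ _ [x /= []]; rewrite !in_itv/= => /andP[x1 x2] /andP[x3 x4].
  by apply: tr => //; exists (x - (c - b)); split; rewrite /= in_itv/=; [exact: truncate_above_sub x1 x2|exact: truncate_above_sub x3 x4].
- by apply: le_lt_trans sd2; apply: ler_sum => i _; have [] := above i.
Qed.

Lemma abs_continuous_reflect a b v : abs_continuous a b v ->
  abs_continuous a b (fun t => - v (a + b - t)).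
Proof.
move=> av e e0; have [del del0 H] := av e e0; exists del => // n l r lr tr sd.
have := H n (fun i => a + b - r i) (fun i => a + b - l i).
have -> : \sum_(i < n) (a + b - l i - (a + b - r i)) = \sum_(i < n) (r i - l i).
  by apply: eq_bigr => i _; ring.
have -> : \sum_(i < n) `|v (a + b - l i) - v (a + b - r i)| =
  \sum_(i < n) `|- v (a + b - r i) - - v (a + b - l i)|.
  by apply: eq_bigr => i _; congr `|_|; ring.
apply => //.
- by move=> i; have [al lri rb] := lr i; split; lra.
- move=> i j _ _ [x /= []]; rewrite !in_itv/= => /andP[x1 x2] /andP[x3 x4].
  apply: tr => //; exists (a + b - x); split; rewrite /= in_itv/=; apply/andP; split; lra.
Qed.

Context (Z : Type) (d : Z -> Z -> R).
Hypotheses (dxx : forall x, d x x = 0) (dsym : forall x y, d x y = d y x)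
  (dtri : forall x y z, d x z <= d x y + d y z).

Lemma ac_path_glue a b c e g1 g2 : g1 b = g2 c ->
  abs_continuous_path d a b g1 -> abs_continuous_path d c e g2 ->
  abs_continuous_path d a (b + (e - c)) (glue b c g1 g2).
Proof.
move=> bc /(ac_pathP dxx dsym dtri)[ab [v1 [av1 gv1]]].
move=> /(ac_pathP dxx dsym dtri)[ce [v2 [av2 gv2]]].
apply/(ac_pathP dxx dsym dtri); split; first lra.
exists (glue b c v1 (fun t => v1 b + (v2 t - v2 c))); split; first exact: abs_continuous_glue.
move=> s t as_ st tb; rewrite /glue.
case: (leP s b) => sb; case: (leP t b) => tb'.
- exact: gv1.
- have := dtri (g1 s) (g1 b) (g2 (t + (c - b))).
  have := gv1 s b as_ sb (lexx _); have := gv2 c (t + (c - b)) (lexx _).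
  have -> : c <= t + (c - b) by lra.
  have -> : t + (c - b) <= e by lra.
  by move=> /(_ isT isT); rewrite -bc; lra.
- by have := le_lt_trans tb' sb; lra.
- have := gv2 (s + (c - b)) (t + (c - b)).
  have -> : c <= s + (c - b) by lra.
  have -> : t + (c - b) <= e by lra.
  have -> : s + (c - b) <= t + (c - b) by lra.
  by move=> /(_ isT isT isT); lra.
Qed.

Lemma ac_path_reflect a b g : abs_continuous_path d a b g ->
  abs_continuous_path d a b (fun t => g (a + b - t)).
Proof.
move=> /(ac_pathP dxx dsym dtri)[ab [v [av gv]]].
apply/(ac_pathP dxx dsym dtri); split => //.
exists (fun t => - v (a + b - t)); split; first exact: abs_continuous_reflect.
move=> s t as_ st tb; rewrite dsym.
have := gv (a + b - t) (a + b - s).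
have -> : a <= a + b - t by lra.
have -> : a + b - t <= a + b - s by lra.
have -> : a + b - s <= b by lra.
by move=> /(_ isT isT isT); lra.
Qed.

End ac_operations.

(** * The warped pseudometric *)

Section warped.
Context (R : realType) (N : R * R -> R) (X Y : Type)
  (dX : X -> X -> R) (dY : Y -> Y -> R) (phi : X -> R).
Notation mu := (@lebesgue_measure R).
Hypothesis (nN : is_norm2 N).
Hypotheses (dXxx : forall x, dX x x = 0) (dXsym : forall x y, dX x y = dX y x)
  (dXtri : forall x y z, dX x z <= dX x y + dX y z).
Hypotheses (dYxx : forall x, dY x x = 0) (dYsym : forall x y, dY x y = dY y x)
  (dYtri : forall x y z, dY x z <= dY x y + dY y z).
Implicit Types (a b c e s t : R) (g : R -> X * Y) (p q r : X * Y).

Let d := l1_dist dX dY.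
Let dxx p : d p p = 0. Proof. by rewrite /d /l1_dist dXxx dYxx addr0. Qed.
Let dsym p q : d p q = d q p. Proof. by rewrite /d /l1_dist dXsym dYsym. Qed.
Let dtri p q r : d p r <= d p q + d q r.
Proof.
by rewrite /d /l1_dist; have := dXtri p.1 q.1 r.1; have := dYtri p.2 q.2 r.2; lra.
Qed.

(** From the triangle inequality for [x] and [- x]. *)
Lemma norm2_ge0 (x : R * R) : 0 <= N x.
Proof.
have [_ Nh Nt] := nN.
have N0 : N 0 = 0 by have := Nh 0 (0, 0); rewrite /= !mul0r normr0 mul0r.
have := Nt x (- x); rewrite subrr N0.
have := Nh (-1) x; rewrite !mulN1r normrN1 mul1r -[(_, _)]/(- x); case: (x) => x1 x2 /= ->; lra.
Qed.

Definition warped_speed a b g t : R :=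
  N (metric_speed dX a b (fst \o g) t,
     phi (g t).1 * metric_speed dY a b (snd \o g) t).

Lemma warped_lengthE a b g : warped_length N dX dY phi a b g =
  (\int[mu]_(t in `[a, b]) (warped_speed a b g t)%:E)%E.
Proof. by []. Qed.

Lemma warped_speed_ge0 a b g t : (0 <= (warped_speed a b g t)%:E)%E.
Proof. by rewrite lee_fin norm2_ge0. Qed.

Lemma warped_speed_congr a b a' b' g g' t (T T' : R -> R) :
  a < t -> t < b -> a' < T t -> T t < b' ->
  (forall u w, `|T u - T w| = `|u - w|) -> cancel T T' -> cancel T' T ->
  (exists2 del : R, 0 < del & forall u, `|u - t| < del -> g u = g' (T u)) ->
  warped_speed a b g t = warped_speed a' b' g' (T t).
Proof.
move=> h1 h2 h3 h4 iT TK T'K [del del0 gg'].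
rewrite /warped_speed (gg' t) ?subrr ?normr0//.
congr (N (_, _ * _)); apply: metric_speed_congr => //.
all: by exists del => // u /gg' /= ->.
Qed.

Lemma ends_null a b : mu ([set a] `|` [set b]) = 0%E.
Proof.
apply/eqP; rewrite eq_le measure_ge0 andbT.
apply: (@le_trans _ _ (mu [set a] + mu [set b])%E); first exact: measureU2.
by rewrite !lebesgue_measure_set1 adde0.
Qed.

(** [warped_pdist p q] is the infimum of the attained values. Working with the
    relation keeps infinite lengths harmless until finiteness is known. *)
Definition attained p q (l : \bar R) : Prop := exists a b g,
  [/\ abs_continuous_path d a b g, g a = p, g b = q &
      l = warped_length N dX dY phi a b g].

Lemma attained_ge0 p q l : attained p q l -> (0 <= l)%E.
Proof.
move=> [a [b [g [_ _ _ ->]]]]; apply: integral_ge0 => t _; exact: warped_speed_ge0.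
Qed.

Lemma le_integral_interior a b f1 f2 : (forall t, 0 <= f1 t) -> (forall t, 0 <= f2 t) ->
  (forall t, a < t -> t < b -> f1 t <= f2 t) ->
  (\int[mu]_(t in `[a, b]) (f1 t)%:E <= \int[mu]_(t in `[a, b]) (f2 t)%:E)%E.
Proof.
move=> f10 f20 f12; apply: (@le_integral_null _ _ ([set a] `|` [set b])).
- exact: measurableU.
- exact: ends_null.
- by move=> t _; rewrite lee_fin.
- by move=> t _; rewrite lee_fin.
- move=> t /=; rewrite in_itv/= => /andP[at_ tb] /not_orP[/eqP ta /eqP tb'].
  by rewrite lee_fin f12// lt_neqAle ?at_ ?tb ?andbT// eq_sym.
Qed.

Lemma attained_trans p q r l1 l2 : attained p q l1 -> attained q r l2 ->
  exists2 l, attained p r l & (l <= l1 + l2)%E.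
Proof.
move=> [a [b [g1 [ac1 g1a g1b ->]]]] [c [e [g2 [ac2 g2c g2e ->]]]].
have bc : g1 b = g2 c by rewrite g1b.
have ab : a <= b by have [[[]]] := ac1.
have ce : c <= e by have [[[]]] := ac2.
pose g := glue b c g1 g2; pose b' := b + (e - c).
exists (warped_length N dX dY phi a b' g).
  exists a, b', g; split => //.
  - exact: ac_path_glue.
  - by rewrite /g /glue ab.
  - rewrite /g /glue /b'; case: leP => h; last by rewrite (_ : _ + _ + _ = e)//; ring.
    have ec : e = c by lra.
    by rewrite ec subrr addr0 bc -ec.
rewrite !warped_lengthE.
apply: (@le_trans _ _ (\int[mu]_(t in `[a, b]) (warped_speed a b' g t)%:E +
                       \int[mu]_(t in `[b, b']) (warped_speed a b' g t)%:E)%E).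
  apply: le_integral_split => [//|t|t]; last exact: warped_speed_ge0.
  rewrite /= !in_itv/= => /andP[-> ->]; rewrite andbT.
  by apply/orP; exact: le_total.
apply: leeD.
  apply: le_integral_interior => [t|t|t at_ tb]; rewrite ?norm2_ge0//.
  rewrite (@warped_speed_congr a b' a b g g1 t id id)//.
    by rewrite /b'; lra.
  exists (b - t); first by lra.
  by move=> u; rewrite ltr_distl /g /glue => /andP[_ h]; have -> : u <= b by lra.
have := @integral_shift_le R (c - b) `[c, e] (fun t => (warped_speed c e g2 t)%:E)
  (fun t => warped_speed_ge0 _ _ _ _).
apply: le_trans.
rewrite (_ : [set x | `[c, e]%classic (x + (c - b))%R] = `[b, b']%classic); last first.
  apply/seteqP; split => t /=; rewrite !in_itv/= /b' => /andP[? ?]; apply/andP; split; lra.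
apply: le_integral_interior => [t|t|t at_ tb]; rewrite ?norm2_ge0//.
rewrite (@warped_speed_congr a b' c e g g2 t (fun t => t + (c - b)) (fun t => t - (c - b)))//.
- by lra.
- by lra.
- by move: tb; rewrite /b'; lra.
- by move=> u w; congr `|_|; ring.
- exact: addrK.
- exact: subrK.
- exists (t - b); first by lra.
  move=> u; rewrite ltr_distl /g /glue => /andP[h _]; have bu : b < u by lra.
  by rewrite leNgt bu.
Qed.

Lemma attained_sym p q l : attained p q l -> exists2 l', attained q p l' & (l' <= l)%E.
Proof.
move=> [a [b [g [ac ga gb ->]]]].
exists (warped_length N dX dY phi a b (fun t => g (a + b - t))).
  exists a, b, (fun t => g (a + b - t)); split => //.
  - exact: ac_path_reflect.
  - by rewrite (_ : a + b - a = b)//; ring.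
  - by rewrite addrK.
rewrite !warped_lengthE.
have := @integral_reflect_le R (a + b) `[a, b] (fun t => (warped_speed a b g t)%:E)
  (fun t => warped_speed_ge0 _ _ _ _).
apply: le_trans.
rewrite (_ : [set x | `[a, b]%classic (a + b - x)%R] = `[a, b]%classic); last first.
  apply/seteqP; split => t /=; rewrite !in_itv/= => /andP[? ?]; apply/andP; split; lra.
apply: le_integral_interior => [t|t|t at_ tb]; rewrite ?norm2_ge0//.
rewrite (@warped_speed_congr a b a b _ g t (fun t => a + b - t) (fun t => a + b - t))//.
- by lra.
- by lra.
- by move=> u w; rewrite distrC; congr `|_|; ring.
- by move=> u; rewrite subKr.
- by move=> u; rewrite subKr.
- by exists 1.
Qed.

Lemma attained_refl p : exists2 l, attained p p l & (l <= 0)%E.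
Proof.
exists (warped_length N dX dY phi 0 0 (fun=> p)).
  exists 0, 0, (fun=> p); split => //.
  apply/(ac_pathP dxx dsym dtri); split => //; exists (fun=> 0); split.
    move=> e e0; exists 1 => // n l r _ _ _; rewrite big1// => i _.
    by rewrite subrr normr0.
  by move=> s t _ _ _; rewrite dxx subrr.
rewrite warped_lengthE.
have := @le_integral_interior 0 0 (warped_speed 0 0 (fun=> p)) (fun=> 0).
by rewrite [X in (_ <= X)%E]integral0; apply => // t; [exact: norm2_ge0|lra].
Qed.

Let W := warped_pdist N dX dY phi.

Lemma warped_pdistE p q : W p q = fine (ereal_inf (attained p q)).
Proof. by []. Qed.

(** [warped_pdist] is the real part of an extended infimum, which would be [0] if
    the infimum were infinite; hence the finite witness. *)
Lemma warped_pdist_ge p q (c : R) : (exists2 l, attained p q l & (l < +oo)%E) ->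
  (forall l, attained p q l -> (c%:E <= l)%E) -> c <= W p q.
Proof.
move=> [l0 al0 l0fin] H; rewrite warped_pdistE -lee_fin fineK.
  by apply: le_ereal_inf_tmp => l /H.
rewrite ge0_fin_numE.
  by apply: le_lt_trans l0fin; exact: ereal_inf_lbound.
by apply: le_ereal_inf_tmp => l /attained_ge0.
Qed.

Lemma warped_pdist_ge0 p q : 0 <= W p q.
Proof. by rewrite fine_ge0//; apply: le_ereal_inf_tmp => l /attained_ge0. Qed.

Lemma warped_pdist_le p q l (c : R) : attained p q l -> (l <= c%:E)%E -> W p q <= c.
Proof.
move=> al lc; rewrite warped_pdistE -lee_fin fineK.
  by apply: le_trans lc; exact: ereal_inf_lbound.
rewrite ge0_fin_numE; last by apply: le_ereal_inf_tmp => l' /attained_ge0.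
by apply: le_lt_trans (ereal_inf_lbound al) _; apply: le_lt_trans lc _; rewrite ltry.
Qed.

Hypothesis connected : forall p q, exists2 l, attained p q l & (l < +oo)%E.

Lemma warped_pdist_adherent p q (e : R) : 0 < e ->
  exists2 l, attained p q l & (l <= (W p q + e)%:E)%E.
Proof.
move=> e0; have fi : ereal_inf (attained p q) \is a fin_num.
  rewrite ge0_fin_numE; last by apply: le_ereal_inf_tmp => l' /attained_ge0.
  have [l al lf] := connected p q; exact: le_lt_trans (ereal_inf_lbound al) lf.
have [l al lW] := lb_ereal_inf_adherent e0 fi.
by exists l => //; apply: ltW; rewrite EFinD warped_pdistE fineK.
Qed.

Lemma warped_pdist_xx p : W p p = 0.
Proof.
apply/eqP; rewrite eq_le warped_pdist_ge0 andbT.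
by have [l al l0] := attained_refl p; apply: warped_pdist_le al l0.
Qed.

Lemma warped_pdist_sym p q : W p q = W q p.
Proof.
suff H x y : W x y <= W y x by apply/eqP; rewrite eq_le !H.
apply/ler_addgt0Pr => e /(warped_pdist_adherent y x)[l /attained_sym[l' al' l'l] lW].
exact: warped_pdist_le al' (le_trans l'l lW).
Qed.

Lemma warped_pdist_triangle p q r : W p r <= W p q + W q r.
Proof.
apply/ler_addgt0Pr => e e0; have e2 : 0 < e / 2 by lra.
have [l1 a1 h1] := warped_pdist_adherent p q e2.
have [l2 a2 h2] := warped_pdist_adherent q r e2.
have [l al hl] := attained_trans a1 a2.
apply: (warped_pdist_le al); apply: le_trans hl _.
apply: le_trans (leeD h1 h2) _; rewrite -EFinD lee_fin; lra.
Qed.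

End warped.

(** * Parametrization by arc length *)

Section arclength.
Context (R : realType) (Z : Type) (d : Z -> Z -> R).
Hypotheses (dxx : forall x, d x x = 0) (dsym : forall x y, d x y = d y x)
  (dtri : forall x y z, d x z <= d x y + d y z).

Lemma is_path_at a b (g : R -> Z) t (e : R) : is_path d a b g -> a <= t -> t <= b -> 0 < e ->
  exists2 del : R, 0 < del & forall u, a <= u -> u <= b -> `|u - t| < del -> d (g u) (g t) < e.
Proof.
move=> [ab cg] at_ tb e0.
have := cg t; rewrite in_itv/= at_ tb => /(_ isT)/cvgrPdist_lt/(_ e e0).
rewrite near_withinE => /nbhs_ballP[del /= del0 H]; exists del => // u au ub ut.
have := H u; rewrite /ball/= in_itv/= au ub distrC => /(_ ut isT).
by rewrite sub0r normrN ger0_norm ?pdist_ge0.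
Qed.

Lemma path_length_xx a (g : R -> Z) : path_length d a a g = 0%E.
Proof.
apply/eqP; rewrite eq_le path_length_ge0// andbT.
apply: ge_ereal_sup => _ [p /itv_partitionxx -> <-] /=.
by rewrite big_nil.
Qed.

(** The parameter [tau s] is the last one at which the length is at most [s]. Just
    after [tau s] the length exceeds [s], and just before [tau t] it is at most
    [t]; continuity of the path, rather than of its length function, then gives
    the Lipschitz bound. On an initial stretch of length [0] the path may move by
    null distances, so in a pseudometric space [h 0] is only at distance [0] from
    [g a]. *)
Lemma arclength_param a b (g : R -> Z) : rectifiable d a b g ->
  let L := fine (path_length d a b g) in
  exists h : R -> Z, [/\ d (g a) (h 0) = 0, h L = g b &
    forall s t, 0 <= s -> s <= t -> d (h s) (h t) <= t - s].
Proof.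
move=> [pg lfin] L; have ab : a <= b by case: pg.
pose v t := fine (path_length d a t g).
have vc : controlled d a b g v by exact: controlled_path_length.
have va : v a = 0 by rewrite /v path_length_xx.
have vmono s t : a <= s -> s <= t -> t <= b -> v s <= v t.
  by move=> as_ st tb; have := vc s t as_ st tb; have := pdist_ge0 dxx dsym dtri (g s) (g t); lra.
pose S s := [set t | [/\ a <= t, t <= b & v t <= s]].
pose tau s := sup (S s).
have Sa s : 0 <= s -> S s a by move=> s0; split; rewrite ?va.
have Sub s : has_ubound (S s) by exists b => t [].
have tau_ge s t : S s t -> t <= tau s by move=> St; exact: ub_le_sup.
have tau_le s : 0 <= s -> tau s <= b.
  by move=> s0; apply: ge_sup; [exists a; exact: Sa|move=> t []].
have a_tau s : 0 <= s -> a <= tau s by move=> s0; apply: tau_ge; exact: Sa.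
have tau_adh s (e : R) : 0 <= s -> 0 < e -> exists2 t, S s t & tau s - e < t.
  by move=> s0 e0; apply: sup_adherent => //; split => //; exists a; exact: Sa.
have v_gt s u : a <= u -> u <= b -> tau s < u -> s < v u.
  by move=> au ub su; rewrite ltNge; apply/negP => vus; have := tau_ge s u (And3 au ub vus); lra.
exists (g \o tau); split => /=.
- apply/eqP; rewrite eq_le pdist_ge0// andbT; apply/ler_addgt0Pr => e e0; rewrite add0r.
  have [del del0 H] := is_path_at pg (a_tau _ (lexx _)) (tau_le _ (lexx _)) e0.
  have [t St ht] := tau_adh 0 del (lexx _) del0.
  have := tau_ge _ _ St; case: St => at_ tb vt tt.
  have := vc a t (lexx _) at_ tb; rewrite va.
  have := H t at_ tb; rewrite ltr_distl => h.
  have : d (g t) (g (tau 0)) < e by apply: h; apply/andP; split; lra.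
  by have := dtri (g a) (g t) (g (tau 0)); lra.
- congr g; apply/eqP; rewrite eq_le; apply/andP; split.
    by apply: tau_le; rewrite /L fine_ge0//; exact: path_length_ge0.
  by apply: tau_ge; split.
- move=> s t s0 st; have t0 := le_trans s0 st.
  have [tst|tst] := leP (tau t) (tau s).
    suff -> : tau s = tau t by rewrite dxx subr_ge0.
    apply/eqP; rewrite eq_le tst andbT; apply: ge_sup; first by exists a; exact: Sa.
    by move=> u [au ub vu]; apply: tau_ge; split => //; exact: le_trans st.
  apply/ler_addgt0Pr => e e0; have e2 : 0 < e / 2 by lra.
  have [d1 d10 H1] := is_path_at pg (a_tau _ s0) (tau_le _ s0) e2.
  have [d2 d20 H2] := is_path_at pg (a_tau _ t0) (tau_le _ t0) e2.
  (* choose [tau s < u < w <= tau t] close to the ends *)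
  pose m := Num.min d1 (tau t - tau s).
  have m0 : 0 < m by rewrite lt_min d10 subr_gt0.
  have m1 : m <= d1 by rewrite ge_min lexx.
  have m2 : m <= tau t - tau s by rewrite ge_min lexx orbT.
  pose u := tau s + m / 2.
  pose m' := Num.min d2 (tau t - u).
  have m'0 : 0 < m' by rewrite lt_min d20 subr_gt0 /u; lra.
  have m'1 : m' <= d2 by rewrite ge_min lexx.
  have m'2 : m' <= tau t - u by rewrite ge_min lexx orbT.
  have [w Sw hw] := tau_adh t m' t0 m'0.
  have := tau_ge _ _ Sw; case: Sw => aw wb vw wt.
  have as_ := a_tau s s0; have tb := tau_le t t0.
  have au : a <= u by rewrite /u; lra.
  have uw : u <= w by lra.
  have ub : u <= b by lra.
  have su : s < v u by apply: v_gt => //; rewrite /u; lra.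
  have h1 : d (g u) (g (tau s)) < e / 2 by apply: H1 => //; rewrite ltr_distl /u; apply/andP; split; lra.
  have h2 : d (g w) (g (tau t)) < e / 2 by apply: H2 => //; rewrite ltr_distl; apply/andP; split; lra.
  have := vc u w au uw wb.
  have := dtri (g (tau s)) (g u) (g (tau t)); have := dtri (g u) (g w) (g (tau t)).
  by rewrite (dsym (g (tau s)) (g u)); lra.
Qed.

(** Also true where the limit does not exist, since the default value is [0]. *)
Lemma metric_speed_lip1 a b (g : R -> Z) t : a < t -> t < b ->
  (forall s u, a <= s -> s <= u -> u <= b -> d (g s) (g u) <= u - s) ->
  0 <= metric_speed d a b g t <= 1.
Proof.
move=> at_ tb lip.
rewrite /metric_speed within_dnbhs//.
have PF : ProperFilter (t^') by exact: Proper_dnbhs_numFieldType.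
set F := fun u : R => d (g u) (g t) / `|u - t|.
have [cF|dF] := pselect (cvg (F @ t^')); last first.
  rewrite (_ : lim (F @ t^') = 0) ?lexx ?ler01//.
  exact: dvgP.
have F01 : \forall u \near t^', 0 <= F u <= 1.
  exists (Num.min (t - a) (b - t)); rewrite /= ?lt_min ?subr_gt0 ?at_ ?tb//.
  move=> u /=; rewrite lt_min => /andP[]; rewrite !ltr_distlC.
  move=> /andP[? ?] /andP[? ?] ut; rewrite /F divr_ge0 ?pdist_ge0//=.
  rewrite ler_pdivrMr ?normr_gt0 ?subr_eq0// mul1r.
  have [h|/ltW h] := leP t u.
    by rewrite dsym ger0_norm ?subr_ge0// lip//; lra.
  by rewrite distrC ger0_norm ?subr_ge0// lip//; lra.
apply/andP; split.
  apply: limr_ge => //; apply: filterS F01 => u /andP[] //.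
by apply: limr_le => //; apply: filterS F01 => u /andP[] //.
Qed.

End arclength.

(** * Upper bounds over a half-line *)

Section euclid.
Context (R : realType).
Lemma euclid_xx (x : {nonneg R}) : euclid_dist x x = 0.
Proof. by rewrite /euclid_dist subrr normr0. Qed.
Lemma euclid_sym (x y : {nonneg R}) : euclid_dist x y = euclid_dist y x.
Proof. by rewrite /euclid_dist distrC. Qed.
Lemma euclid_tri (x y z : {nonneg R}) :
  euclid_dist x z <= euclid_dist x y + euclid_dist y z.
Proof. exact: ler_distD. Qed.

Lemma max0_ge0 (u : R) : 0 <= Num.max 0 u.
Proof. by rewrite le_max lexx. Qed.
(** Truncation at [0], to parametrize paths in the half-line by real numbers. *)
Definition nng (u : R) : {nonneg R} := NngNum (max0_ge0 u).
Lemma nngE u : 0 <= u -> (nng u)%:num = u.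
Proof. by move=> u0; rewrite /= max_r. Qed.
Lemma nngK (s : {nonneg R}) : nng s%:num = s.
Proof. by apply/val_inj; rewrite /= max_r. Qed.
End euclid.

Section filling_paths.
Context (R : realType) (N : R * R -> R) (Y : metricType R) (phi : {nonneg R} -> R).
Notation mu := (@lebesgue_measure R).
Hypotheses (nN : is_norm2 N) (uN : unitary_norm N) (cN : coordinate_increasing N).
Hypotheses (phi_ge0 : forall x, 0 <= phi x) (lY : length_space (@mdist R Y)).
Implicit Types (y : Y) (s t : {nonneg R}).

Local Notation ed := (@euclid_dist R).
Local Notation dY := (@mdist R Y).
Let exx := @euclid_xx R.
Let esy := @euclid_sym R.
Let etri := @euclid_tri R.
Let yxx := @mdistxx R Y.
Let ysym := @metric_sym R Y.
Let ytri := @metric_triangle R Y.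
Let dxx (p : {nonneg R} * Y) : l1_dist ed dY p p = 0.
Proof. by rewrite /l1_dist exx yxx addr0. Qed.
Let dsym (p q : {nonneg R} * Y) : l1_dist ed dY p q = l1_dist ed dY q p.
Proof. by rewrite /l1_dist esy ysym. Qed.
Let dtri (p q r : {nonneg R} * Y) : l1_dist ed dY p r <= l1_dist ed dY p q + l1_dist ed dY q r.
Proof.
by rewrite /l1_dist; have := etri p.1 q.1 r.1; have := ytri p.2 q.2 r.2; lra.
Qed.

Notation attained := (attained N ed dY phi).

Lemma lipschitz_ac_path a b (g : R -> {nonneg R} * Y) : a <= b ->
  (forall u w, a <= u -> u <= w -> w <= b -> l1_dist ed dY (g u) (g w) <= w - u) ->
  abs_continuous_path (l1_dist ed dY) a b g.
Proof.
move=> ab lip; apply/(ac_pathP dxx dsym dtri); split => //; exists id; split => //.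
move=> e e0; exists e => // n l r lr tr; apply: le_lt_trans.
apply: ler_sum => i _; have [_ h _] := lr i.
by rewrite ger0_norm ?subr_ge0.
Qed.

Let int_cst a b (c : R) : a <= b -> (\int[mu]_(t in `[a, b]) c%:E = (c * (b - a))%:E)%E.
Proof.
move=> ab; rewrite integral_cst//= lebesgue_measure_itv/= lte_fin; case: ltP => h //.
by rewrite (_ : b = a) ?subrr ?mulr0 ?mule0//; apply/eqP; rewrite eq_le ab h.
Qed.

Let speed_const (Z : Type) (d : Z -> Z -> R) (z : Z) (a b t : R) : d z z = 0 ->
  a < t -> t < b -> metric_speed d a b (fun=> z) t = 0.
Proof.
move=> zz at_ tb; apply: metric_speedE => // e e0; exists 1 => // u _ _.
by rewrite zz mul0r subr0 normr0.
Qed.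

Lemma attained_vertical s t y : exists2 l, attained (s, y) (t, y) l & (l <= `|s%:num - t%:num|%:E)%E.
Proof.
wlog st : s t / s%:num <= t%:num.
  move=> H; have [/H//|/ltW/H[l al ll]] := leP s%:num t%:num.
  have [l' al' l'l] := @attained_sym R N _ _ ed dY phi nN exx esy etri yxx ysym ytri _ _ _ al.
  by exists l' => //; apply: le_trans l'l _; rewrite distrC.
pose g (u : R) := (nng u, y).
exists (warped_length N ed dY phi s%:num t%:num g).
  exists s%:num, t%:num, g; split; rewrite /g ?nngK//.
  apply: lipschitz_ac_path => // u w su uw wt.
  rewrite /l1_dist/= yxx addr0 /euclid_dist.
  have u0 : 0 <= u by exact: le_trans su.
  by rewrite !nngE// ?(le_trans u0)// distrC ger0_norm ?subr_ge0.
rewrite warped_lengthE distrC ger0_norm ?subr_ge0//.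
rewrite -[X in X%:E]mul1r -int_cst//.
apply: le_integral_interior => // [u|u su ut]; first exact: norm2_ge0.
rewrite /warped_speed.
have -> : metric_speed ed s%:num t%:num (fst \o g) u = 1.
  apply: metric_speedE => // e e0; exists (u - s%:num); first by rewrite subr_gt0.
  move=> w wu; rewrite ltr_distl => /andP[h _].
  have w0 : 0 <= w by apply: le_trans (ge0 s) _; lra.
  have u0 : 0 <= u by apply: le_trans (ge0 s) _; lra.
  rewrite /g/= /euclid_dist !nngE// divff ?subrr ?normr0//.
  by rewrite normr_eq0 subr_eq0.
have -> : metric_speed dY s%:num t%:num (snd \o g) u = 0 by exact: speed_const.
by rewrite mulr0; case: uN => -> _.
Qed.

Lemma attained_horizontal s y y' (e : R) : 0 < e ->
  exists2 l, attained (s, y) (s, y') l & (l <= (phi s * (dY y y' + e))%:E)%E.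
Proof.
move=> e0; have [_ dE] := lY y y'.
have fi : ereal_inf [set l | exists (a b : R) (g : R -> Y),
        [/\ rectifiable dY a b g, g a = y, g b = y' & l = path_length dY a b g]] \is a fin_num.
  by rewrite -dE.
have [_ [a [b [g [rg ga gb ->]]]]] := lb_ereal_inf_adherent e0 fi.
rewrite -dE -EFinD => Lle.
have [h [h0 hL hlip]] := arclength_param yxx ysym ytri rg.
set L := fine _ in hL.
have L0 : 0 <= L by rewrite fine_ge0//; apply: path_length_ge0 => //; case: rg => -[].
have Ld : L <= dY y y' + e.
  rewrite -lee_fin /L fineK; first exact: ltW.
  by rewrite ge0_fin_numE ?(lt_le_trans Lle) ?leey//; apply: path_length_ge0 => //; case: rg => -[].
pose k (u : R) := (s, h u).
exists (warped_length N ed dY phi 0 L k).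
  exists 0, L, k; split; rewrite /k ?hL ?gb//.
    apply: lipschitz_ac_path => // u w u0 uw wL.
    by rewrite /l1_dist/= exx add0r hlip.
  by congr pair; rewrite -ga; apply/esym/mdist_positivity.
apply: (@le_trans _ _ (phi s * (L - 0))%:E); last by rewrite lee_fin subr0 ler_wpM2l.
rewrite warped_lengthE -int_cst//.
apply: le_integral_interior => // [u|u u0 uL]; first exact: norm2_ge0.
rewrite /warped_speed.
have -> : metric_speed ed 0 L (fst \o k) u = 0 by exact: speed_const.
have /andP[m0 m1] : 0 <= metric_speed dY 0 L (snd \o k) u <= 1.
  by apply: metric_speed_lip1 => // x w x0 xw _; exact: hlip.
have [_ u01] := uN; have [_ Nh _] := nN.
apply: (@le_trans _ _ (N (0, phi s * 1))).
  by apply: cN; rewrite ?mulr_ge0// ler_wpM2l.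
have := Nh (phi s) (0, 1); rewrite /= mulr0 u01 mulr1 => ->.
by rewrite ger0_norm// mulr1.
Qed.

(** Descend from height [s] to height [u], cross, and climb to height [t]. *)
Lemma attained_upper s t u y y' (e : R) : u%:num <= s%:num -> u%:num <= t%:num -> 0 < e ->
  exists2 l, attained (s, y) (t, y') l &
    (l <= (s%:num + t%:num - 2 * u%:num + phi u * (dY y y' + e))%:E)%E.
Proof.
move=> us ut e0.
have [l1 a1 h1] := attained_vertical s u y.
have [l2 a2 h2] := attained_horizontal u y y' e0.
have [l3 a3 h3] := attained_vertical u t y'.
have T := @attained_trans R N _ _ ed dY phi nN exx esy etri yxx ysym ytri.
have [l12 a12 h12] := T _ _ _ _ _ a1 a2.
have [l al h] := T _ _ _ _ _ a12 a3.
exists l => //; apply: le_trans h _; apply: le_trans (leeD h12 h3) _.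
apply: le_trans (leeD (leeD h1 h2) (lexx _)) _; rewrite -!EFinD lee_fin.
by rewrite ger0_norm ?subr_ge0// distrC ger0_norm ?subr_ge0//; lra.
Qed.

Lemma filling_connected p q : exists2 l, attained p q l & (l < +oo)%E.
Proof.
case: p q => s y [t y'].
have [l al h] := @attained_upper s t 0%:nng y y' 1 (ge0 _) (ge0 _) ltr01.
by exists l => //; apply: le_lt_trans h _; rewrite ltry.
Qed.

Let W := warped_pdist N ed dY phi.

Lemma filling_upper s t u y y' : u%:num <= s%:num -> u%:num <= t%:num ->
  W (s, y) (t, y') <= s%:num + t%:num - 2 * u%:num + phi u * dY y y'.
Proof.
move=> us ut; have [p0|p0] := eqVneq (phi u) 0.
  have [l al h] := @attained_upper s t u y y' 1 us ut ltr01.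
  apply: (warped_pdist_le nN al); apply: le_trans h _.
  by rewrite lee_fin p0 !mul0r.
apply/ler_addgt0Pr => e e0.
have pu : 0 < phi u by rewrite lt_neqAle eq_sym p0 phi_ge0.
have e0' : 0 < e / phi u by rewrite divr_gt0.
have [l al h] := @attained_upper s t u y y' _ us ut e0'.
apply: (warped_pdist_le nN al); apply: le_trans h _.
by rewrite lee_fin mulrDr mulrCA divff// mulr1; lra.
Qed.

End filling_paths.

(** * Height and displacement along a path *)

Section profile.
Context (R : realType) (N : R * R -> R) (Y : metricType R) (Phi : R -> R).
Notation mu := (@lebesgue_measure R).
Hypotheses (nN : is_norm2 N) (uN : unitary_norm N) (cN : coordinate_increasing N).
Hypotheses (Phi_ge0 : forall x, 0 <= x -> 0 <= Phi x)
  (Phi_mono : forall x y, 0 <= x -> x <= y -> Phi x <= Phi y)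
  (mPhi : measurable_fun [set: R] Phi).
Let phi (s : {nonneg R}) := Phi s%:num.
Local Notation ed := (@euclid_dist R).
Local Notation dY := (@mdist R Y).

Let dxx (p : {nonneg R} * Y) : l1_dist ed dY p p = 0.
Proof. by rewrite /l1_dist euclid_xx mdistxx addr0. Qed.
Let dsym (p q : {nonneg R} * Y) : l1_dist ed dY p q = l1_dist ed dY q p.
Proof. by rewrite /l1_dist euclid_sym metric_sym. Qed.
Let dtri (p q r : {nonneg R} * Y) : l1_dist ed dY p r <= l1_dist ed dY p q + l1_dist ed dY q r.
Proof.
by rewrite /l1_dist; have := euclid_tri p.1 q.1 r.1; have := metric_triangle p.2 q.2 r.2; lra.
Qed.

Lemma metric_speed_clamp (Z : Type) (d : Z -> Z -> R) a b (g : R -> Z) t m :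
  a < t -> t < b ->
  (forall e : R, 0 < e -> exists2 del : R, 0 < del &
      forall u : R, u != t -> `|u - t| < del ->
       `|d (g (clamp a b u)) (g (clamp a b t)) / `|u - t| - m| < e) ->
  metric_speed d a b g t = m.
Proof.
move=> at_ tb H; apply: metric_speedE => // e /H[del del0 {}H].
exists (Num.min del (Num.min (t - a) (b - t))).
  by rewrite !lt_min del0 !subr_gt0 at_.
move=> u ut; rewrite !lt_min => /andP[ud /andP[]].
rewrite !ltr_distl => /andP[au _] /andP[_ ub].
have {}au : a <= u by lra.
have {}ub : u <= b by lra.
by have := H u ut ud; rewrite (clamp_id au ub) (clamp_id (ltW at_) (ltW tb)) ltr_distl.
Qed.

(** The only lower bound on the norm that the estimates use. *)
Lemma max_le_norm2 x z : 0 <= x -> 0 <= z -> Num.max x z <= N (x, z).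
Proof.
move=> x0 z0; have [_ Nh _] := nN; have [u10 u01] := uN.
rewrite ge_max; apply/andP; split.
  have {1}-> : x = N (x, 0).
    by have := Nh x (1, 0); rewrite /= mulr0 mulr1 u10 mulr1 => ->; rewrite ger0_norm.
  by apply: cN.
have {1}-> : z = N (0, z).
  by have := Nh z (0, 1); rewrite /= mulr0 mulr1 u01 mulr1 => ->; rewrite ger0_norm.
by apply: cN.
Qed.

(** What remains of a path of finite warped length: its height [r], its projection
    [y] and its length function [L], all as functions of the parameter. Heights
    change at most as fast as [L]; above height [h], displacement costs at least
    [Phi h] per unit. All measure theory is contained in [filling_profile], which
    produces profiles. *)
Record profile (p q : {nonneg R} * Y) (a b : R) (r : R -> R) (y : R -> Y) (L : R -> R) : Prop := Profile {
  profile_le : a <= b;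
  profile_pa : r a = p.1%:num /\ y a = p.2;
  profile_qb : r b = q.1%:num /\ y b = q.2;
  profile_r : forall s t, a <= s -> s <= t -> t <= b -> `|r t - r s| <= L t - L s;
  profile_y : forall s t h, a <= s -> s <= t -> t <= b -> 0 <= h ->
    (forall u, s <= u -> u <= t -> h <= r u) -> Phi h * dY (y s) (y t) <= L t - L s;
  profile_ivt : forall s t c, a <= s -> s <= t -> t <= b -> L s <= c -> c <= L t ->
    exists u, [/\ s <= u, u <= t & L u = c] }.

(** Take for [L] the primitive of [max (mX, Phi (r) mY)], where [mX] and [mY] are
    the metric speeds of the coordinates. It is at most the warped length, as the
    norm dominates the maximum. *)
Lemma filling_profile p q (l : \bar R) : attained N ed dY phi p q l -> (l < +oo)%E ->
  exists a b r y L, profile p q a b r y L /\ ((L b - L a)%:E <= l)%E.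
Proof.
move=> [a [b [g [/(ac_pathP dxx dsym dtri)[ab [v [av gv]]] ga gb ->]]]] lfin.
pose c := clamp a b.
pose vc := v \o c.
have gvc : ac_on_line vc by exact: ac_on_line_clamp.
have va t : t <= a -> vc t = vc a.
  by move=> ta; rewrite /vc /= /c (clamp_l ab ta) (clamp_l ab (lexx a)).
have vb t : b <= t -> vc t = vc b.
  by move=> tb; rewrite /vc /= /c (clamp_r ab tb) (clamp_r ab (lexx b)).
have gc s t : s <= t -> l1_dist ed dY (g (c s)) (g (c t)) <= vc t - vc s.
  move=> st; apply: gv; [exact: clamp_ge|exact: clamp_mono|exact: clamp_le].
have gX s t : s <= t -> ed (g (c s)).1 (g (c t)).1 <= vc t - vc s.
  by move=> /gc; rewrite /l1_dist; have := mdist_ge0 (g (c s)).2 (g (c t)).2; lra.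
have gY s t : s <= t -> dY (g (c s)).2 (g (c t)).2 <= vc t - vc s.
  by move=> /gc; rewrite /l1_dist /euclid_dist; have := normr_ge0 ((g (c s)).1%:num - (g (c t)).1%:num); lra.
have [mX [mX0 mXi mXd mXae]] := metric_speed_ae (@euclid_xx R) (@euclid_sym R)
  (@euclid_tri R) (g := fun t => (g (c t)).1) gvc va vb gX.
have [mY [mY0 mYi mYd mYae]] := metric_speed_ae (@mdistxx R Y) (@metric_sym R Y)
  (@metric_triangle R Y) (g := fun t => (g (c t)).2) gvc va vb gY.
pose r t := (g (c t)).1%:num.
have rc : continuous r.
  move=> t; apply/cvgrPdist_lt => e e0.
  move: (@ac_on_line_continuous R vc gvc t) => /cvgrPdist_lt /(_ e e0).
  apply: filterS => u h.
  have [tu|/ltW ut] := leP t u.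
    by apply: le_lt_trans (gX _ _ tu) _; move: h; rewrite ltr_norml; lra.
  rewrite distrC; apply: le_lt_trans (gX _ _ ut) _; move: h; rewrite ltr_norml; lra.
have mr : measurable_fun [set: R] r by exact: continuous_measurable_fun.
have mfun (k : R -> R) : mu.-integrable [set: R] (EFin \o k) -> measurable_fun [set: R] k.
  by move=> /integrableP[/measurable_EFinP].
pose G t := Num.max (mX t) (Phi (r t) * mY t).
have mG : measurable_fun [set: R] G.
  apply: measurable_maxr; first exact: mfun.
  apply: measurable_funM; last exact: mfun.
  exact: (measurableT_comp mPhi mr).
have r0 t : 0 <= r t by rewrite /r.
have G0 t : 0 <= G t by rewrite /G le_max mX0.
have GW : (\int[mu]_(t in `[a, b]) (G t)%:E <= warped_length N ed dY phi a b g)%E.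
  move: mXae mYae => [NX [mNX NX0 HX]] [NY [mNY NY0 HY]].
  apply: (@le_integral_null _ _ (([set a] `|` [set b]) `|` (NX `|` NY))).
  - by apply: measurableU; apply: measurableU.
  - apply/eqP; rewrite eq_le measure_ge0 andbT.
    apply: (@le_trans _ _ (mu ([set a] `|` [set b]) + mu (NX `|` NY))%E).
      by apply: measureU2; apply: measurableU.
    rewrite ends_null add0e; apply: (@le_trans _ _ (mu NX + mu NY)%E); first exact: measureU2.
    by rewrite NX0 NY0 adde0.
  - by move=> t _; rewrite lee_fin.
  - by move=> t _; exact: warped_speed_ge0.
  - move=> t /=; rewrite in_itv/= => /andP[at_ tb] /not_orP[/not_orP[/eqP ta /eqP tb'] /not_orP[nX nY]].
    have at' : a < t by rewrite lt_neqAle at_ eq_sym ta.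
    have tb'' : t < b by rewrite lt_neqAle tb tb'.
    rewrite lee_fin.
    have -> : metric_speed ed a b (fst \o g) t = mX t.
      by apply: metric_speed_clamp => //; apply: contrapT => h; apply: nX; exact: HX.
    have -> : metric_speed dY a b (snd \o g) t = mY t.
      by apply: metric_speed_clamp => //; apply: contrapT => h; apply: nY; exact: HY.
    rewrite /G (_ : phi (g t).1 = Phi (r t)); last by rewrite /r /c clamp_id.
    by apply: max_le_norm2 => //; rewrite mulr_ge0// Phi_ge0.
have Gi : mu.-integrable `[a, b] (EFin \o G).
  apply/integrableP; split; first exact/measurable_EFinP/measurable_funTS.
  apply: le_lt_trans lfin; apply: le_trans GW.
  by under eq_integral do rewrite /= ger0_norm//.
pose L t := \int[mu]_(u in `[a, t]) G u.
have Gsub s t : a <= s -> t <= b -> mu.-integrable `]s, t] (EFin \o G).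
  move=> as_ tb; apply: (integrableS _ _ _ Gi) => //.
  by move=> u /=; rewrite !in_itv/= => /andP[? ?]; apply/andP; split; lra.
have LB s t : a <= s -> s <= t -> t <= b -> L t - L s = \int[mu]_(u in `]s, t]) G u.
  move=> as_ st tb; rewrite /L Rintegral_itvB//.
  apply: (integrableS _ _ _ Gi) => //.
  by move=> u /=; rewrite !in_itv/= => /andP[? ?]; apply/andP; split; lra.
have Laa : L a = 0.
  by rewrite /L set_itv1 Rintegral_set1.
exists a, b, r, (fun t => (g (c t)).2), L; split; last first.
  rewrite Laa subr0 /L /Rintegral fineK//.
  exact: integrable_fin_num.
split => //.
- by rewrite /r /c clamp_id// ga.
- by rewrite /r /c clamp_id// gb.
- move=> s t as_ st tb; rewrite LB// distrC.
  apply: le_trans (mXd _ _ st) _; rewrite primitive_diff//.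
  apply: le_Rintegral => //; [exact: integrableS mXi|exact: Gsub|].
  by move=> u _; rewrite /G le_max lexx.
- move=> s t h as_ st tb h0 hr; rewrite LB//.
  apply: (@le_trans _ _ (Phi h * (primitive mY t - primitive mY s))).
    by rewrite ler_wpM2l ?Phi_ge0// mYd.
  rewrite primitive_diff// -RintegralZl//; last exact: integrableS mYi.
  apply: le_Rintegral => //; last first.
  + move=> u /=; rewrite in_itv/= => /andP[su ut].
    rewrite /G le_max; apply/orP; right; rewrite ler_wpM2r// Phi_mono// hr//.
    exact: ltW.
  + exact: Gsub.
  + by apply: (integrableS measurableT _ _ (integrableZl measurableT (Phi h) mYi)).
- move=> s t z as_ st tb Lsz zLt.
  have cL := parameterized_integral_continuous ab Gi.
  have cL' : {within `[s, t], continuous L}.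
    apply: continuous_subspaceW cL => u /=; rewrite !in_itv/= => /andP[? ?]; apply/andP; split; lra.
  have [|u uin uz] := @IVT R L s t z st cL'.
    by rewrite ge_min Lsz le_max zLt orbT.
  by exists u; move: uin; rewrite in_itv/= => /andP[? ?].
Qed.

End profile.

(** * The warped distance up to an additive constant *)

Section estimate.
Context (R : realType) (Y : metricType R) (Phi : R -> R) (alpha kappa B : R).
Local Notation dY := (@mdist R Y).
Hypotheses (a0 : 0 < alpha) (k0 : 0 < kappa) (B0 : 0 <= B).
Hypotheses (Phi_lb : forall u, 1 <= u -> kappa * expR (alpha * u) <= Phi u)
  (Phi_ub : forall u, 0 <= u -> Phi u <= expR (alpha * u))
  (Phi_B : forall y y', Phi 0 * dY y y' <= B).

(** The sum of the geometric series [kappa^-1 (1 + e^{-alpha} + e^{-2 alpha} + ...)]. *)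
Definition half_const : R := (kappa * (1 - expR (- alpha)))^-1.

Let ea1 : expR (- alpha) < 1.
Proof. by rewrite -[ltRHS]expR0 ltr_expR oppr_lt0. Qed.

Let K := half_const.

Let K_eq : K * expR (- alpha) + kappa^-1 = K.
Proof.
rewrite /K /half_const; have := ea1; set x := expR _ => x1.
have h1 : 1 - x != 0 by rewrite gt_eqF// subr_gt0.
have h2 : kappa != 0 by rewrite gt_eqF.
by field; rewrite h1 h2.
Qed.

Let Kk : kappa^-1 <= K.
Proof.
rewrite -[leRHS]K_eq lerDr mulr_ge0 ?expR_ge0// /K /half_const invr_ge0.
by apply: mulr_ge0; rewrite ?subr_ge0; exact: ltW.
Qed.

(** Along a path of length [l] that starts at height [r a], height is at least
    [r a - l]. Cut into pieces of length [1] counted from the end: the piece at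
    distance [k] from the end displaces by at most
    [kappa^-1 e^{-alpha (r a - l + k)}]. The sum is a geometric series, handled by
    induction on the number of pieces. *)
Lemma profile_half p q a b r y L : profile Phi p q a b r y L ->
  forall v, a <= v -> v <= b -> 1 <= r a - (L v - L a) ->
  dY (y a) (y v) <= K * expR (- (alpha * (r a - (L v - L a)))).
Proof.
move=> P; have ab := profile_le P.
have Lm s t : a <= s -> s <= t -> t <= b -> L s <= L t.
  move=> as_ st tb; have := profile_r P as_ st tb.
  by have := normr_ge0 (r t - r s); lra.
have piece u v : a <= u -> u <= v -> v <= b -> L v - L u <= 1 ->
    1 <= r a - (L v - L a) ->
    dY (y u) (y v) <= kappa^-1 * expR (- (alpha * (r a - (L v - L a)))).
  move=> au uv vb Luv h1; set h := r a - _ in h1 *.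
  have Lh w : u <= w -> w <= v -> h <= r w.
    move=> uw wv; have aw := le_trans au uw; have wb := le_trans wv vb.
    have := profile_r P (lexx a) aw wb; have := Lm w v aw wv vb.
    by rewrite ler_norml /h; lra.
  have h0 : 0 <= h by lra.
  have := profile_y P au uv vb h0 Lh.
  have := Phi_lb h1 => lb.
  have := mdist_ge0 (y u) (y v) => d0 H.
  have : kappa * expR (alpha * h) * dY (y u) (y v) <= 1.
    by apply: le_trans (ler_wpM2r d0 lb) _; lra.
  rewrite expRN -invfM -ler_pdivlMl ?mulr_gt0 ?expR_gt0//.
  by rewrite mulr1.
suff main n v : a <= v -> v <= b -> L v - L a <= n%:R -> 1 <= r a - (L v - L a) ->
    dY (y a) (y v) <= K * expR (- (alpha * (r a - (L v - L a)))).
  move=> v av vb; apply: (main (Num.bound (L v - L a))) => //.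
  by apply/ltW/archi_boundP; rewrite subr_ge0 Lm.
elim: n v => [|n IH] v av vb Ln h1.
  apply: le_trans (piece _ _ (lexx a) av vb _ h1) _; first lra.
  by rewrite ler_wpM2r ?expR_ge0.
have [L1|L1] := leP (L v - L a) 1.
  apply: le_trans (piece _ _ (lexx a) av vb _ h1) _; first lra.
  by rewrite ler_wpM2r ?expR_ge0.
(* split off the last piece of length [1] *)
have [||u [au uv Lu]] := profile_ivt P (c := L v - 1) (lexx a) av vb.
- by lra.
- by lra.
have ub := le_trans uv vb.
have {}IH := IH u au ub.
have E1 : L u - L a = L v - L a - 1 by lra.
rewrite E1 in IH.
have := metric_triangle (y a) (y u) (y v).
have := piece u v au uv vb _ h1.
have -> : L v - L u <= 1 by lra.
move=> /(_ isT) H2 H3.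
have H1 : dY (y a) (y u) <= K * expR (- (alpha * (r a - (L v - L a - 1)))).
  by apply: IH; [rewrite -natr1 in Ln; lra|lra].
rewrite -[in leRHS]K_eq mulrDl -mulrA -expRD.
rewrite (_ : - alpha + _ = - (alpha * (r a - (L v - L a - 1)))); last by ring.
lra.
Qed.

Lemma profile_reverse (p q : {nonneg R} * Y) a b r y L : profile Phi p q a b r y L ->
  profile Phi q p a b (fun t => r (a + b - t)) (fun t => y (a + b - t))
    (fun t => - L (a + b - t)).
Proof.
move=> P; have ab := profile_le P; split => //.
- by rewrite (_ : a + b - a = b); [exact: profile_qb P|ring].
- by rewrite addrK; exact: profile_pa P.
- move=> s t as_ st tb; rewrite distrC.
  have := @profile_r _ _ _ _ _ _ _ _ _ _ P (a + b - t) (a + b - s).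
  have -> : a <= a + b - t by lra.
  have -> : a + b - t <= a + b - s by lra.
  have -> : a + b - s <= b by lra.
  by move=> /(_ isT isT isT); lra.
- move=> s t h as_ st tb h0 H; rewrite metric_sym.
  have := @profile_y _ _ _ _ _ _ _ _ _ _ P (a + b - t) (a + b - s) h.
  have -> : a <= a + b - t by lra.
  have -> : a + b - t <= a + b - s by lra.
  have -> : a + b - s <= b by lra.
  move=> /(_ isT isT isT h0) HH; apply: (le_trans (HH _)); last by lra.
  by move=> u u1 u2; have := H (a + b - u); rewrite subKr; apply; lra.
- move=> s t c as_ st tb c1 c2.
  have := @profile_ivt _ _ _ _ _ _ _ _ _ _ P (a + b - t) (a + b - s) (- c).
  have -> : a <= a + b - t by lra.
  have -> : a + b - t <= a + b - s by lra.
  have -> : a + b - s <= b by lra.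
  have -> : L (a + b - t) <= - c by lra.
  have -> : - c <= L (a + b - s) by lra.
  move=> /(_ isT isT isT isT isT)[u [u1 u2 Lu]].
  by exists (a + b - u); rewrite subKr Lu opprK; split => //; lra.
Qed.

Definition lower_const : R := expR alpha + 2 * K.

Lemma half_const_ge0 : 0 <= K.
Proof. by apply: le_trans Kk; rewrite invr_ge0 ltW. Qed.

Lemma lower_const_ge1 : 1 <= lower_const.
Proof. by have := half_const_ge0; have : 1 < expR alpha; [rewrite expR_gt1|rewrite /lower_const; lra]. Qed.

(** Cut the path where its length function reaches [s - c]. Each half, read from its
    outer end point, satisfies the hypotheses of [profile_half] with remaining
    height exactly [c]. If [c < 1] the right-hand side is at least [1]. *)
Lemma profile_lower p q a b r y L : profile Phi p q a b r y L ->
  let c := (p.1%:num + q.1%:num - (L b - L a)) / 2 in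
  [/\ c <= p.1%:num, c <= q.1%:num &
    Num.min 1 (dY p.2 q.2) <= lower_const * expR (- (alpha * c))].
Proof.
move=> P; have ab := profile_le P; have [ra ya] := profile_pa P.
have [rb yb] := profile_qb P; move=> c.
have := profile_r P (lexx a) ab (lexx b); rewrite ra rb ler_norml => /andP[h1 h2].
split; [by rewrite /c; lra|by rewrite /c; lra|].
have ce : 0 < expR (- (alpha * c)) by exact: expR_gt0.
have [c1|c1] := leP 1 c; last first.
  apply: (@le_trans _ _ 1); first by rewrite ge_min lexx.
  apply: (@le_trans _ _ (expR alpha * expR (- (alpha * c)))).
    rewrite -expRD -[leLHS]expR0 ler_expR.
    have : alpha * c < alpha * 1 by rewrite ltr_pM2l.
    lra.
  by apply: ler_wpM2r; [exact: ltW|rewrite /lower_const lerDl mulr_ge0// half_const_ge0].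
have [||w [aw wb Lw]] := profile_ivt P (c := L a + p.1%:num - c) (lexx a) ab (lexx b).
- by rewrite /c; lra.
- by rewrite /c; lra.
have H1 := profile_half P aw wb.
have E1 : r a - (L w - L a) = c by rewrite ra Lw; lra.
rewrite E1 in H1; have {}H1 := H1 c1.
have := @profile_half _ _ _ _ _ _ _ (profile_reverse P) (a + b - w).
have ba : a + b - a = b by ring.
rewrite /= ba !subKr.
have -> : a <= a + b - w by lra.
have -> : a + b - w <= b by lra.
have -> : r b - (- L w - - L b) = c by rewrite rb Lw /c; lra.
move=> /(_ isT isT c1) H2.
rewrite -ya -yb; apply: (@le_trans _ _ (dY (y a) (y b))); first by rewrite ge_min lexx orbT.
have := metric_triangle (y a) (y w) (y b); rewrite (metric_sym (y w)) => H3.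
have : expR alpha * expR (- (alpha * c)) >= 0 by rewrite mulr_ge0// expR_ge0.
rewrite /lower_const mulrDl; lra.
Qed.

Implicit Types p q : {nonneg R} * Y.

(** Comparable to [e^{-alpha (p|q)}], where [(p|q)] is the Gromov product based at
    height [0]; unlike the latter it is an explicit formula and satisfies the
    triangle inequality exactly. *)
Definition rho p q : R :=
  Num.max (Num.max (expR (- (alpha * p.1%:num))) (expR (- (alpha * q.1%:num))))
    (Num.min 1 (dY p.2 q.2)).

Definition confluence p q : R := - ln (rho p q) / alpha.

Lemma rho_gt0 p q : 0 < rho p q.
Proof. by rewrite /rho !lt_max expR_gt0. Qed.

Lemma rho_le1 p q : rho p q <= 1.
Proof.
rewrite /rho !ge_max ge_min lexx andbT.
have a0' := ltW a0.
by apply/andP; split; rewrite -[leRHS]expR0 ler_expR oppr_le0 mulr_ge0.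
Qed.

Lemma expR_confluence p q : expR (alpha * confluence p q) = (rho p q)^-1.
Proof.
by rewrite /confluence mulrCA divff ?gt_eqF// mulr1 expRN lnK// posrE rho_gt0.
Qed.

Lemma rho_sym p q : rho p q = rho q p.
Proof. by rewrite /rho metric_sym; congr (Num.max _ _); rewrite maxC. Qed.

Lemma rho_triangle p q s : rho p q <= rho p s + rho s q.
Proof.
have h1 := rho_gt0 p s; have h2 := rho_gt0 s q.
have p1 : expR (- (alpha * p.1%:num)) <= rho p s by rewrite /rho !le_max lexx.
have q1 : expR (- (alpha * q.1%:num)) <= rho s q by rewrite /rho !le_max lexx orbT.
have d1 : Num.min 1 (dY p.2 s.2) <= rho p s by rewrite /rho le_max lexx orbT.
have d2 : Num.min 1 (dY s.2 q.2) <= rho s q by rewrite /rho le_max lexx orbT.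
rewrite {1}/rho !ge_max; apply/andP; split; first by apply/andP; split; lra.
apply: le_trans (lerD d1 d2).
have := metric_triangle p.2 s.2 q.2; have := mdist_ge0 p.2 s.2; have := mdist_ge0 s.2 q.2.
by case: (leP 1 (dY p.2 q.2)); case: (leP 1 (dY p.2 s.2)); case: (leP 1 (dY s.2 q.2)); lra.
Qed.

Lemma confluence_sym p q : confluence p q = confluence q p.
Proof. by rewrite /confluence rho_sym. Qed.

Lemma confluence_ultra p q s :
  Num.min (confluence p s) (confluence s q) - ln 2 / alpha <= confluence p q.
Proof.
have := rho_triangle p q s; have h1 := rho_gt0 p s; have h2 := rho_gt0 s q.
rewrite lerBlDr -mulrDl ge_min !(ler_pM2r (_ : 0 < alpha^-1)) ?invr_gt0// => H.
have [le|/ltW le] := leP (rho s q) (rho p s).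
  apply/orP; left; rewrite lerNl opprD opprK lerBlDr -lnM ?posrE//.
  by rewrite ler_ln ?posrE ?mulr_gt0 ?rho_gt0//; lra.
apply/orP; right; rewrite lerNl opprD opprK lerBlDr -lnM ?posrE//.
by rewrite ler_ln ?posrE ?mulr_gt0 ?rho_gt0//; lra.
Qed.

Lemma confluence_ge0 p q : 0 <= confluence p q.
Proof. by rewrite /confluence divr_ge0 ?(ltW a0)// oppr_ge0 ln_le0// rho_le1. Qed.

Lemma confluence_le p q : confluence p q <= p.1%:num /\ confluence p q <= q.1%:num.
Proof.
have H (x : R) : expR (- (alpha * x)) <= rho p q -> confluence p q <= x.
  move=> h; rewrite /confluence ler_pdivrMr// lerNl -ler_expR lnK ?posrE ?rho_gt0//.
  by rewrite mulrC.
by split; apply: H; rewrite /rho !le_max lexx ?orbT.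
Qed.

Context (N : R * R -> R).
Hypotheses (nN : is_norm2 N) (uN : unitary_norm N) (cN : coordinate_increasing N).
Hypotheses (Phi_ge0 : forall x, 0 <= x -> 0 <= Phi x)
  (Phi_mono : forall x y, 0 <= x -> x <= y -> Phi x <= Phi y)
  (mPhi : measurable_fun [set: R] Phi) (lY : length_space dY).

Let W := warped_pdist N (@euclid_dist R) dY (fun s => Phi s%:num).

Definition estimate_const : R := 1 + B + 2 * (ln lower_const / alpha).

Let lnm0 : 0 <= ln lower_const / alpha.
Proof. by rewrite divr_ge0 ?(ltW a0)// ln_ge0// lower_const_ge1. Qed.

Lemma estimate_const_ge0 : 0 <= estimate_const.
Proof.
apply: addr_ge0; first exact: addr_ge0.
by apply: mulr_ge0 => //; exact: lnm0.
Qed.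

(** The lower bound is [profile_lower]. For the upper bound, cross at the confluence
    height: if [d <= 1] the cost is at most [d / rho p q <= 1], and if [d > 1] that
    height is [0], where crossing costs at most [B]. *)
Lemma filling_estimate p q :
  `|W p q - (p.1%:num + q.1%:num - 2 * confluence p q)| <= estimate_const.
Proof.
have lm := lnm0.
suff : p.1%:num + q.1%:num - 2 * confluence p q - 2 * (ln lower_const / alpha) <= W p q
    /\ W p q <= p.1%:num + q.1%:num - 2 * confluence p q + (1 + B).
  rewrite ler_distl /estimate_const; move: lm; set z := ln _ / _ => lm [h1 h2].
  apply/andP; split; last by lra.
  by apply: le_trans h1; have := B0; lra.
split.
  apply: warped_pdist_ge => //.
    by apply: filling_connected => // s; exact: Phi_ge0.
  move=> l al; have [lfin|] := ltP l +oo%E; last by rewrite leye_eq => /eqP ->; rewrite leey.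
  have [a [b [r [y [L [P Ll]]]]]] :=
    filling_profile nN uN cN Phi_ge0 Phi_mono mPhi al lfin.
  apply: le_trans Ll; rewrite lee_fin.
  have [c1 c2 c3] := profile_lower P; set c := _ / 2 in c1 c2 c3.
  have mc := lower_const_ge1.
  have m1 x : c <= x -> expR (- (alpha * x)) <= lower_const * expR (- (alpha * c)).
    move=> cx; apply: (@le_trans _ _ (expR (- (alpha * c)))).
      by rewrite ler_expR lerN2 ler_pM2l.
    by rewrite ler_peMl ?expR_ge0.
  have : rho p q <= lower_const * expR (- (alpha * c)).
    by rewrite /rho !ge_max c3 !m1.
  rewrite -ler_ln ?posrE ?mulr_gt0 ?expR_gt0 ?rho_gt0//; last lra.
  rewrite lnM ?posrE ?expR_gt0//; last lra.
  rewrite expRK => H.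
  have : c <= confluence p q + ln lower_const / alpha.
    by rewrite /confluence -mulrDl ler_pdivlMr// mulrC; lra.
  by rewrite /c; lra.
case: p q => s y [t y']; set p := (s, y); set q := (t, y').
have [m1 m2] := confluence_le p q; have m0 := confluence_ge0 p q.
have Phi0 (u : {nonneg R}) : 0 <= Phi u%:num by exact: Phi_ge0.
have := @filling_upper R N Y (fun s => Phi s%:num) nN uN cN
  Phi0 lY s t (nng (confluence p q)) y y'.
rewrite nngE// => /(_ m1 m2) H; apply: (le_trans H); rewrite lerD2l.
have d0 := mdist_ge0 y y'.
have [d1|d1] := leP (dY y y') 1.
  apply: (@le_trans _ _ 1); last by have := B0; lra.
  apply: le_trans (ler_wpM2r d0 (Phi_ub m0)) _.
  rewrite expR_confluence ler_pdivrMl ?rho_gt0// mulr1.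
  by rewrite /rho le_max (min_r d1) lexx orbT.
have r1 : rho p q = 1.
  by apply/eqP; rewrite eq_le rho_le1 /rho le_max (min_l (ltW d1)) lexx orbT.
rewrite (_ : confluence p q = 0); last by rewrite /confluence r1 ln1 oppr0 mul0r.
by have := Phi_B y y'; have := B0; lra.
Qed.

End estimate.

(** * Quotients and the four-point condition *)

Section quotient_metric.
Context (R : realType) (T : Type) (W : T -> T -> R).
Hypotheses (W_ge0 : forall p q, 0 <= W p q) (Wxx : forall p, W p p = 0)
  (Wsym : forall p q, W p q = W q p)
  (Wtri : forall p q r, W p r <= W p q + W q r).
Let E p q := W p q = 0.
Let dQ (C D : quotient E) : R := W (quotient_repr C) (quotient_repr D).

Lemma quotient_reprP (U : Type) (F : U -> U -> Prop) (C : quotient F) :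
  sval C = [set q | F (quotient_repr C) q].
Proof. by rewrite /quotient_repr; case: cid. Qed.

Definition quotient_class (U : Type) (F : U -> U -> Prop) (p : U) : quotient F :=
  exist _ [set q | F p q] (ex_intro _ p erefl).

Lemma quotient_eq (U : Type) (F : U -> U -> Prop) (C D : quotient F) :
  sval C = sval D -> C = D.
Proof.
by case: C D => [C hC] [D hD] /= CD; subst D; congr exist; exact: Prop_irrelevance.
Qed.

Lemma quotient_class_repr p : W (quotient_repr (quotient_class E p)) p = 0.
Proof.
have := quotient_reprP (quotient_class E p) => /= /seteqP[_ /(_ p)] H.
rewrite Wsym.
have /seteqP[_ H'] := quotient_reprP (quotient_class E p).
by have := H' (quotient_repr (quotient_class E p)); apply; exact: Wxx.
Qed.

Lemma quotient_metric : is_metric dQ.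
Proof.
split => [C D|C D|C D|C D F]; rewrite /dQ //.
split=> [CD|->//]; apply: quotient_eq; rewrite !quotient_reprP.
apply/seteqP; split => r /= h; apply/eqP; rewrite eq_le W_ge0 andbT.
  by apply: le_trans (Wtri _ (quotient_repr C) _) _; rewrite Wsym CD h addr0.
by apply: le_trans (Wtri _ (quotient_repr D) _) _; rewrite CD h addr0.
Qed.

End quotient_metric.

Section hyperbolicity.
Context (R : realType) (T : Type) (W : T -> T -> R) (h : T -> R) (M : T -> T -> R) (C c : R).
Hypotheses (Msym : forall p q, M p q = M q p)
  (Multra : forall p q s, Num.min (M p s) (M s q) - c <= M p q)
  (WM : forall p q, `|W p q - (h p + h q - 2 * M p q)| <= C).

Lemma approx_gromov_product w p q :
  `|gromov_product W w p q - (h w - M p w - M q w + M p q)| <= 3 / 2 * C.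
Proof.
have := WM p w; have := WM q w; have := WM p q.
by rewrite !ler_norml /gromov_product; lra.
Qed.

(** Whichever of the four products on the left is largest, the two ultrametric
    inequalities through that pair give the claim. *)
Lemma ultra_four_point x y z w : 
  Num.min (M x z + M y w) (M y z + M x w) - 2 * c <= M x y + M z w.
Proof.
have := Multra x y z; have := Multra z w x; have := Multra z w y; have := Multra x y w.
rewrite (Msym z x) (Msym z y) (Msym w y).
case: (leP (M x z) (M y z)); case: (leP (M x z) (M x w)); case: (leP (M y z) (M y w));
case: (leP (M x w) (M y w)); case: (leP (M x z + M y w) (M y z + M x w)); lra.
Qed.

Lemma approx_four_point x y z w :
  Num.min (gromov_product W w x z) (gromov_product W w y z) - (3 * C + 2 * c) <= gromov_product W w x y.
Proof.
have := approx_gromov_product w x z; have := approx_gromov_product w y z.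
have := approx_gromov_product w x y; have := ultra_four_point x y z w.
rewrite !ler_norml.
case: (leP (gromov_product W w x z) (gromov_product W w y z));
case: (leP (M x z + M y w) (M y z + M x w)); lra.
Qed.

End hyperbolicity.

(** * Chain distances and snowflakes *)

Section chain_distance.
Context (R : realType) (Z : Type) (q : Z -> Z -> R).

Definition chain_dist (x y : Z) : R :=
  inf [set \sum_(0 <= i < size s) q (nth y (x :: s) i) (nth y (x :: s) i.+1)
      | s in [set s | last x s = y]].

Local Notation csum := (chain_sum q).
Variables (e : Z -> Z -> R) (A : R).
Hypotheses (A0 : 0 < A) (e_ge0 : forall x y, 0 <= e x y) (exx : forall x, e x x = 0)
  (e_eq : forall x y, e x y = 0 -> x = y)
  (etri : forall x y z, e x z <= e x y + e y z)
  (qsym : forall x y, q x y = q y x)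
  (qlb : forall x y, A^-1 * e x y <= q x y) (qub : forall x y, q x y <= A * e x y).

(** If [q] is at least a multiple of a metric, chains cannot be shorter than the
    direct step by more than that factor. *)
Lemma chain_sum_ge x s : A^-1 * e x (last x s) <= csum x s.
Proof.
elim: s x => [|z s IH] x /=; first by rewrite exx mulr0.
apply: le_trans (lerD (qlb x z) (IH z)).
by rewrite -mulrDr ler_wpM2l// invr_ge0 ltW.
Qed.

Lemma chain_dist_le x y s : last x s = y -> chain_dist x y <= csum x s.
Proof.
move=> sy; apply: ge_inf; last by exists s => //; rewrite chain_sumE.
exists 0 => _ [t _ <-]; rewrite chain_sumE; apply: le_trans (chain_sum_ge x t).
by rewrite mulr_ge0// invr_ge0 ltW.
Qed.

Lemma chain_dist_ge x y (c : R) : (forall s, last x s = y -> c <= csum x s) ->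
  c <= chain_dist x y.
Proof.
move=> H; apply: lb_le_inf; first by exists (\sum_(0 <= i < size [:: y]) q (nth y [:: x; y] i) (nth y [:: x; y] i.+1)), [:: y].
by move=> _ [s sy <-]; rewrite chain_sumE; exact: H.
Qed.

Lemma chain_dist_adherent x y (ep : R) : 0 < ep ->
  exists2 s, last x s = y & csum x s < chain_dist x y + ep.
Proof.
move=> ep0; apply: contrapT => H.
have : chain_dist x y + ep <= chain_dist x y; last by lra.
apply: chain_dist_ge => s sy; rewrite leNgt; apply/negP => h; apply: H.
by exists s.
Qed.

Lemma chain_reverse x s : exists2 t, last (last x s) t = x & csum (last x s) t = csum x s.
Proof.
elim: s x => [|z s IH] x /=; first by exists [::].
have [t tz tE] := IH z; exists (rcons t x); first by rewrite last_rcons.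
by rewrite -cats1 chain_sum_cat tE tz/= addr0 addrC qsym.
Qed.

Lemma chain_dist_lb x y : A^-1 * e x y <= chain_dist x y.
Proof. by apply: chain_dist_ge => s <-; exact: chain_sum_ge. Qed.

Lemma chain_dist_ub x y : chain_dist x y <= A * e x y.
Proof.
apply: le_trans (qub x y); have := @chain_dist_le x y [:: y] erefl.
by rewrite /= addr0.
Qed.

Lemma chain_dist_metric : is_metric chain_dist.
Proof.
split => [x y|x y|x y|x y z].
- by apply: le_trans (chain_dist_lb x y); rewrite mulr_ge0// invr_ge0 ltW.
- split=> [xy|->]; last first.
    apply/eqP; rewrite eq_le; apply/andP; split.
      by have := chain_dist_ub y y; rewrite exx mulr0.
    by have := chain_dist_lb y y; rewrite exx mulr0.
  apply: e_eq; apply/eqP; rewrite eq_le e_ge0 andbT.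
  by have := chain_dist_lb x y; rewrite xy pmulr_rle0// invr_gt0.
- suff H a b : chain_dist a b <= chain_dist b a by apply/eqP; rewrite eq_le !H.
  apply: chain_dist_ge => s <-; have [t ta tE] := chain_reverse b s.
  by rewrite -tE; exact: chain_dist_le.
- apply/ler_addgt0Pr => ep ep0; have ep2 : 0 < ep / 2 by lra.
  have [s sy hs] := chain_dist_adherent x y ep2.
  have [t tz ht] := chain_dist_adherent y z ep2.
  have := @chain_dist_le x z (s ++ t); rewrite last_cat sy => /(_ tz).
  by rewrite chain_sum_cat sy; lra.
Qed.

End chain_distance.

Section snowflake.
Context (R : realType).
Implicit Types (a b th A : R).

(** Since [th <= 1], [x / (a + b) <= (x / (a + b)) `^ th]; add this for [x = a]
    and [x = b]. *)
Lemma powR_subadditive a b th : 0 < th -> th <= 1 -> 0 <= a -> 0 <= b ->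
  (a + b) `^ th <= a `^ th + b `^ th.
Proof.
move=> th0 th1 a0 b0.
have [ab|] := ltP 0 (a + b); last first.
  move=> ab; have -> : a = 0 by lra.
  have -> : b = 0 by lra.
  by rewrite addr0 powR0 ?gt_eqF// addr0.
have key x : 0 <= x -> x <= a + b -> x / (a + b) * (a + b) `^ th <= x `^ th.
  rewrite le_eqVlt => /predU1P[<-|x0] xab; first by rewrite !mul0r powR_ge0.
  rewrite -{2}(divfK (lt0r_neq0 ab) x) powRM ?divr_ge0 ?(ltW x0) ?(ltW ab)//.
  rewrite ler_wpM2r ?powR_ge0// ger1_powR// divr_gt0//=.
  by rewrite ler_pdivrMr// mul1r.
have h1 := key a a0 (_ : a <= a + b); have h2 := key b b0 (_ : b <= a + b).
apply: le_trans (lerD (h1 _) (h2 _)); try lra.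
by rewrite -mulrDl -mulrDl divff ?lt0r_neq0// mul1r.
Qed.

Lemma powR_gt_pow a b th : 0 < th -> 0 <= a -> 0 <= b -> a `^ th < b -> a < b `^ th^-1.
Proof.
move=> th0 a0 b0 h.
have := @gt0_ltr_powR R th^-1 _ (a `^ th) b; rewrite invr_gt0 !nnegrE => /(_ th0 (powR_ge0 _ _) b0 h).
by rewrite -powRrM divff ?gt_eqF// powRr1.
Qed.

(** A strictly increasing bijection of the half-line is continuous: the preimages of
    [f x - e / 2] and [f x + e / 2] bound a neighbourhood of [x]. *)
Lemma monotone_homeomorphism (f g : {nonneg R} -> {nonneg R}) :
  cancel f g -> cancel g f ->
  (forall s t, s%:num < t%:num -> (f s)%:num < (f t)%:num) ->
  dist_continuous (@euclid_dist R) (@euclid_dist R) f.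
Proof.
move=> fg gf fm x e e0.
have fm' s t : (f s)%:num < (f t)%:num -> s%:num < t%:num.
  move=> h; rewrite ltNge le_eqVlt; apply/negP => /predU1P[ts|/fm]; last by lra.
  by move: h; rewrite (_ : s = t) ?ltxx//; exact/val_inj.
have hi0 : 0 <= (f x)%:num + e / 2 by rewrite addr_ge0// divr_ge0// ltW.
pose hi := g (NngNum hi0).
have xhi : x%:num < hi%:num by apply: fm'; rewrite /hi gf/=; lra.
have [lo|lo] := ltP 0 ((f x)%:num - e / 2); last first.
  exists (hi%:num - x%:num); first by rewrite subr_gt0.
  move=> y; rewrite /euclid_dist ltr_distl => /andP[h1 h2].
  have : (f y)%:num < (f x)%:num + e / 2.
    by have := fm y hi; rewrite /hi gf/=; apply; rewrite -/hi; lra.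
  have : 0 <= (f y)%:num by [].
  by move=> h5 h6; rewrite /euclid_dist ltr_distl; apply/andP; split; lra.
pose lo' := g (NngNum (ltW lo)).
have lox : lo'%:num < x%:num by apply: fm'; rewrite /lo' gf/=; lra.
exists (Num.min (hi%:num - x%:num) (x%:num - lo'%:num)).
  by rewrite lt_min !subr_gt0 xhi.
move=> y; rewrite /euclid_dist lt_min => /andP[]; rewrite !ltr_distl => /andP[h1 h2] /andP[h3 h4].
have : (f y)%:num < (f x)%:num + e / 2.
  by have := fm y hi; rewrite /hi gf/=; apply; rewrite -/hi; lra.
have : (f x)%:num - e / 2 < (f y)%:num.
  by have := fm lo' y; rewrite /lo' gf/=; apply; rewrite -/lo'; lra.
by move=> h5 h6; apply/andP; split; lra.
Qed.

Lemma power_gauge_homeomorphism (c p : R) : 0 < c -> 0 < p ->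
  exists2 eta : {nonneg R} -> {nonneg R},
    homeomorphism (@euclid_dist R) (@euclid_dist R) eta &
    forall t, (eta t)%:num = c * t%:num `^ p.
Proof.
move=> c0 p0.
have f0 (t : {nonneg R}) : 0 <= c * t%:num `^ p by rewrite mulr_ge0 ?powR_ge0// ltW.
have g0 (t : {nonneg R}) : 0 <= (t%:num / c) `^ p^-1 by exact: powR_ge0.
pose f t := NngNum (f0 t); pose g t := NngNum (g0 t).
have fg : cancel f g.
  move=> t; apply/val_inj => /=.
  by rewrite mulrAC divff ?gt_eqF// mul1r -powRrM divff ?gt_eqF// powRr1.
have gf : cancel g f.
  move=> t; apply/val_inj => /=.
  rewrite -powRrM mulVf ?gt_eqF// powRr1; last by rewrite divr_ge0// ltW.
  by rewrite mulrC divfK// gt_eqF.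
have fm (s t : {nonneg R}) : s%:num < t%:num -> (f s)%:num < (f t)%:num.
  by move=> st; rewrite /= ltr_pM2l// gt0_ltr_powR ?nnegrE.
have gm (s t : {nonneg R}) : s%:num < t%:num -> (g s)%:num < (g t)%:num.
  move=> st; rewrite /= gt0_ltr_powR ?invr_gt0 ?nnegrE ?divr_ge0 ?(ltW c0)//.
  by rewrite ltr_pM2r ?invr_gt0.
exists f => //; split; first exact: (monotone_homeomorphism fg gf fm).
by exists g; split => //; exact: (monotone_homeomorphism gf fg gm).
Qed.

(** If [dB] is within a factor [A] of [mdist `^ th], ratios of distances satisfy
    the bound with [eta r = (A^2 r) `^ (1 / th)]. *)
Lemma snowflake_quasisymmetric (Z : Type) (dB : Z -> Z -> R) (Y : metricType R)
    (f : Z -> Y) (g : Y -> Z) (th A : R) : 0 < th -> 0 < A ->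
  is_metric dB -> cancel f g -> cancel g f ->
  (forall x y, A^-1 * mdist (f x) (f y) `^ th <= dB x y) ->
  (forall x y, dB x y <= A * mdist (f x) (f y) `^ th) ->
  quasisymmetrically_homeomorphic dB (@mdist R Y).
Proof.
move=> th0 A0 mB fg gf lb ub.
have thi0 : 0 < th^-1 by rewrite invr_gt0.
have mY : is_metric (@mdist R Y).
  split => [x y|x y|x y|x y z]; [exact: mdist_ge0| |exact: metric_sym|exact: metric_triangle].
  by split=> [|->]; [exact: mdist_positivity|exact: mdistxx].
split => //; exists f; split; [split|].
- move=> x e e0; exists (A^-1 * e `^ th); first by rewrite mulr_gt0 ?invr_gt0 ?powR_gt0.
  move=> y h; have := le_lt_trans (lb x y) h.
  rewrite ltr_pM2l ?invr_gt0// => /(powR_gt_pow th0 (mdist_ge0 _ _) (powR_ge0 _ _)).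
  by rewrite -powRrM divff ?gt_eqF// powRr1// ltW.
- exists g; split => // x e e0; exists ((e / A) `^ th^-1); first by apply: powR_gt0; exact: divr_gt0.
  move=> y h; apply: le_lt_trans (ub _ _) _; rewrite !gf mulrC -ltr_pdivlMr//.
  have := @gt0_ltr_powR R th th0 _ _ _ _ h; rewrite !nnegrE => /(_ (mdist_ge0 _ _) (powR_ge0 _ _)).
  by rewrite -powRrM mulVf ?gt_eqF// powRr1// divr_ge0 ?ltW.
- have [eta heta etaE] := @power_gauge_homeomorphism ((A * A) `^ th^-1) th^-1
    (powR_gt0 _ (mulr_gt0 A0 A0)) thi0.
  exists eta; split => // x y z xy yz xz r rE; rewrite etaE rE.
  have [B0 B1 _ _] := mB.
  have dxz : 0 < mdist (f x) (f z).
    by rewrite mdist_gt0; apply/eqP => /(can_inj fg).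
  have bxz : 0 < dB x z by rewrite lt_neqAle B0 andbT eq_sym; apply/eqP => /B1.
  rewrite -powRM ?mulr_ge0 ?invr_ge0 ?(ltW A0) ?B0//.
  set q := mdist _ _ / mdist _ _.
  have q0 : 0 <= q by rewrite divr_ge0 ?mdist_ge0.
  have qE : q = (q `^ th) `^ th^-1 by rewrite -powRrM divff ?gt_eqF// powRr1.
  rewrite qE; apply: ge0_ler_powR; rewrite ?(ltW thi0) ?nnegrE ?powR_ge0//.
    by apply: mulr_ge0; [exact/ltW/mulr_gt0|exact: divr_ge0].
  have VE : (mdist (f x) (f z))^-1 `^ th = (mdist (f x) (f z) `^ th)^-1.
    by rewrite -(powR_inv1 (ltW dxz)) -powRrM mulN1r powRN.
  rewrite /q powRM ?invr_ge0 ?mdist_ge0// VE.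
  rewrite (_ : A * A * _ = (A * dB x y) * (A / dB x z)); last by ring.
  apply: ler_pM; rewrite ?powR_ge0 ?invr_ge0 ?powR_ge0//.
    by rewrite -ler_pdivrMl.
  by rewrite -[X in _ <= X]invrK lef_pV2 ?posrE ?powR_gt0 ?invr_gt0 ?divr_gt0// invfM invrK mulrC ler_pdivrMr// mulrC.
Qed.

End snowflake.

(** * The Gromov boundary *)

Section boundary.
Context (R : realType) (Y : metricType R) (alpha : R) (Z : Type) (d : Z -> Z -> R)
  (x0 : Z) (lift : Z -> {nonneg R} * Y) (C : R).
Hypotheses (a0 : 0 < alpha) (dsym : forall x y, d x y = d y x).
Local Notation gp := (gromov_product d x0).
Local Notation ht z := (lift z).1%:num.
Local Notation pr z := (lift z).2.
Local Notation lrho x y := (rho alpha (lift x) (lift y)).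
Hypothesis gpM : forall x y, `|gp x y - confluence alpha (lift x) (lift y)| <= C.
Hypothesis dense_lift : forall y (e : R), 0 < e ->
  exists z, expR (- (alpha * ht z)) < e /\ mdist (pr z) y < e.
Hypothesis cY : is_complete Y.

Lemma complete_seq (u : nat -> Y) :
  (forall e : R, 0 < e -> exists n, forall i, (n <= i)%N -> mdist (u n) (u i) < e) ->
  exists y, forall e : R, 0 < e -> exists n, forall i, (n <= i)%N -> mdist (u i) y < e.
Proof.
move=> cu; have [|y uy] := cY (F := u @ \oo) _.
  apply/cauchyP => e e0; have [n un] := cu e e0; exists (u n).
  by exists n => // i /= ni; rewrite ballEmdist/=; exact: un.
exists y => e e0; have : (u @ \oo) (ball y e) by apply: uy; exact: nbhsx_ballx.
by move=> [n _ un]; exists n => i ni; have := un i ni; rewrite /= ballEmdist/= metric_sym.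
Qed.

(** Heights tend to infinity (in the form [e^{-alpha ht} -> 0]) and projections
    tend to [y]. This describes Gromov sequences and their classes completely. *)
Definition converges (u : nat -> Z) (y : Y) : Prop := forall e : R, 0 < e ->
  exists n, forall i, (n <= i)%N -> expR (- (alpha * ht (u i))) < e /\ mdist (pr (u i)) y < e.

Lemma rho_lt_gp x y (A : R) : lrho x y < expR (- (alpha * (A + C))) -> A <= gp x y.
Proof.
have r0 := rho_gt0 alpha (lift x) (lift y).
rewrite -ltr_ln ?posrE ?expR_gt0// expRK => h.
have : A + C <= confluence alpha (lift x) (lift y).
  by rewrite /confluence ler_pdivlMr// mulrC; lra.
by have := gpM x y; rewrite ler_norml; lra.
Qed.

Lemma gp_ge_rho x y (e : R) : 0 < e -> - ln e / alpha + C + 1 <= gp x y -> lrho x y < e.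
Proof.
move=> e0 h; have r0 := rho_gt0 alpha (lift x) (lift y).
have : - ln e / alpha < confluence alpha (lift x) (lift y).
  by have := gpM x y; rewrite ler_norml; lra.
by rewrite /confluence ltr_pM2r ?invr_gt0// ltrN2 ltr_ln.
Qed.

Lemma rho_lt x y (e : R) : lrho x y < e -> e <= 1 ->
  [/\ expR (- (alpha * ht x)) < e, expR (- (alpha * ht y)) < e & mdist (pr x) (pr y) < e].
Proof.
by rewrite /rho !gt_max gt_min => /andP[/andP[-> ->]/orP[]]//; lra.
Qed.

Lemma lt_rho x y (e : R) : expR (- (alpha * ht x)) < e -> expR (- (alpha * ht y)) < e ->
  mdist (pr x) (pr y) < e -> lrho x y < e.
Proof. by move=> h1 h2 h3; rewrite /rho !gt_max gt_min h1 h2 h3 orbT. Qed.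

Lemma gromov_sequence_converges u : is_gromov_sequence d x0 u -> exists y, converges u y.
Proof.
move=> /cvgryPge gu.
have small (e : R) : 0 < e -> exists n, forall i j, (n <= i)%N -> (n <= j)%N -> lrho (u i) (u j) < e.
  move=> e0; have [[P Q] [[n _ Pn] [m _ Qm]] PQ] := gu (- ln e / alpha + C + 1).
  exists (maxn n m) => i j ni nj; apply: gp_ge_rho => //; apply: (PQ (i, j)).
  split; [apply: Pn|apply: Qm]; apply: leq_trans; [|exact: ni| |exact: nj];
    by rewrite ?leq_maxl ?leq_maxr.
have small1 (e : R) : 0 < e -> exists n, forall i j, (n <= i)%N -> (n <= j)%N ->
    expR (- (alpha * ht (u i))) < e /\ mdist (pr (u i)) (pr (u j)) < e.
  move=> e0; have m0 : 0 < Num.min e 1 by rewrite lt_min e0 ltr01.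
  have [n un] := small _ m0; exists n => i j ni nj.
  have m1 : Num.min e 1 <= 1 by rewrite ge_min lexx orbT.
  have [h1 _ h2] := rho_lt (un i j ni nj) m1.
  have m2 : Num.min e 1 <= e by rewrite ge_min lexx.
  by split; lra.
have [|y uy] := @complete_seq (fun i => pr (u i)).
  move=> e /small1[n un]; exists n => i ni; by have [] := un n i (leqnn _) ni.
exists y => e e0; have [n un] := small1 e e0; have [m um] := uy e e0.
exists (maxn n m) => i; rewrite geq_max => /andP[ni mi].
by have [h _] := un i i ni ni; split=> //; exact: um.
Qed.

Lemma converges_rho u v y : converges u y -> converges v y -> forall e : R, 0 < e ->
  exists n, forall i j, (n <= i)%N -> (n <= j)%N -> lrho (u i) (v j) < e.
Proof.
move=> uy vy e e0; have e2 : 0 < e / 2 by lra.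
have [n un] := uy _ e2; have [m vm] := vy _ e2; exists (maxn n m) => i j.
rewrite !geq_max => /andP[ni mi] /andP[nj mj].
have [h1 h2] := un i ni; have [h3 h4] := vm j mj.
apply: lt_rho; try lra.
by have := metric_triangle (pr (u i)) y (pr (v j)); rewrite (metric_sym y); lra.
Qed.

Lemma converges_gp u v y : converges u y -> converges v y -> forall A : R,
  exists n, forall i j, (n <= i)%N -> (n <= j)%N -> A <= gp (u i) (v j).
Proof.
move=> uy vy A; have [n H] := converges_rho uy vy (expR_gt0 (- (alpha * (A + C)))).
by exists n => i j ni nj; apply: rho_lt_gp; exact: H.
Qed.

Lemma converges_gromov_sequence u y : converges u y -> is_gromov_sequence d x0 u.
Proof.
move=> uy; apply/cvgryPge => A; have [n H] := converges_gp uy uy A.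
exists ([set i | (n <= i)%N], [set i | (n <= i)%N]); first by split; exists n.
by move=> [i j] [/= ni nj]; exact: H.
Qed.

Lemma converges_equiv (u v : gromov_sequence d x0) y : converges (sval u) y ->
  gromov_equiv u v <-> converges (sval v) y.
Proof.
move=> uy; split=> [/cvgryPge uv|vy].
  move=> e e0; have e2 : 0 < e / 2 by lra.
  have m0 : 0 < Num.min (e / 2) 1 by rewrite lt_min e2 ltr01.
  have m1 : Num.min (e / 2) 1 <= 1 by rewrite ge_min lexx orbT.
  have m2 : Num.min (e / 2) 1 <= e / 2 by rewrite ge_min lexx.
  have [n _ un] := uv (- ln (Num.min (e / 2) 1) / alpha + C + 1).
  have [m um] := uy _ e2; exists (maxn n m) => i; rewrite geq_max => /andP[ni mi].
  have [h1 h2 h3] := rho_lt (gp_ge_rho m0 (un i ni)) m1.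
  have [h4 h5] := um i mi; split; first lra.
  have := metric_triangle (pr (sval v i)) (pr (sval u i)) y.
  by rewrite (metric_sym (pr (sval v i)) (pr (sval u i))); lra.
apply/cvgryPge => A; have [n H] := converges_gp uy vy A.
by exists n => // i /= ni; exact: H.
Qed.

Lemma converges_unique u y y' : converges u y -> converges u y' -> y = y'.
Proof.
move=> uy uy'; apply: mdist_positivity; apply/eqP; rewrite eq_le mdist_ge0 andbT.
apply/ler_addgt0Pr => e e0; have e2 : 0 < e / 2 by lra.
have [n un] := uy _ e2; have [m um] := uy' _ e2.
have [_ h1] := un (maxn n m) (leq_maxl _ _); have [_ h2] := um (maxn n m) (leq_maxr _ _).
by have := metric_triangle y (pr (u (maxn n m))) y'; rewrite (metric_sym y (pr _)); lra.
Qed.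

(** The points of the filling are equivalence classes, so a sequence is chosen by
    approximation rather than written down; hence the hypothesis [dense_lift]. *)
Lemma converges_exists y : exists u : gromov_sequence d x0, converges (sval u) y.
Proof.
have /choice[u uP] n : exists z, expR (- (alpha * ht z)) < n.+1%:R^-1 /\ mdist (pr z) y < n.+1%:R^-1.
  by apply: dense_lift; rewrite invr_gt0.
have uy : converges u y.
  move=> e e0; have := near_infty_natSinv_lt (PosNum e0) => -[n _ H].
  exists n => i ni; have [h1 h2] := uP i; have /= h3 := H i ni.
  by split; [exact: lt_trans h3|exact: lt_trans h3].
by exists (exist _ u (converges_gromov_sequence uy)).
Qed.

Local Notation bd := (gromov_boundary d x0).

Lemma boundary_endpoint (x : bd) : exists y, forall u, sval x u <-> converges (sval u) y.
Proof.
case: x => X [u XE] /=; have [y uy] := gromov_sequence_converges (svalP u).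
by exists y => v; rewrite XE /=; exact: converges_equiv.
Qed.

Definition endpoint (x : bd) : Y := sval (cid (boundary_endpoint x)).

Lemma endpointP x u : sval x u <-> converges (sval u) (endpoint x).
Proof. by rewrite /endpoint; case: cid. Qed.

Lemma endpoint_inj : injective endpoint.
Proof.
move=> x y xy; apply: quotient_eq; apply/seteqP; split => u.
  by move=> /endpointP; rewrite xy => /endpointP.
by move=> /endpointP; rewrite -xy => /endpointP.
Qed.

Lemma endpoint_surj y : exists x, endpoint x = y.
Proof.
have [u uy] := converges_exists y.
exists (quotient_class (@gromov_equiv R Z d x0) u).
have : sval (quotient_class (@gromov_equiv R Z d x0) u) u.
  by apply/(converges_equiv u uy).
by move=> /endpointP uy'; exact: converges_unique uy' uy.
Qed.

Lemma limf_einf_ge (f : nat * nat -> R) (c : R) n :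
  (forall i j, (n <= i)%N -> (n <= j)%N -> c <= f (i, j)) ->
  (c%:E <= limf_einf (fun ij => (f ij)%:E) (filter_prod \oo \oo))%E.
Proof.
move=> H; rewrite limf_einfE; apply: (@le_trans _ _ (ereal_inf ((fun ij => (f ij)%:E) @` ([set i | (n <= i)%N] `*` [set i | (n <= i)%N])))).
  by apply: le_ereal_inf_tmp => _ [[i j] [/= ni nj] <-]; rewrite lee_fin H.
apply: ereal_sup_ubound; exists ([set i | (n <= i)%N] `*` [set i | (n <= i)%N]) => //.
by exists ([set i | (n <= i)%N], [set i | (n <= i)%N]) => //; split; exists n.
Qed.

Lemma limf_einf_le (f : nat * nat -> R) (c : R) n :
  (forall i j, (n <= i)%N -> (n <= j)%N -> f (i, j) <= c) ->
  (limf_einf (fun ij => (f ij)%:E) (filter_prod \oo \oo) <= c%:E)%E.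
Proof.
move=> H; rewrite limf_einfE; apply: ge_ereal_sup => _ [V [[P Q] [[m _ Pm] [k _ Qk]] PQ] <-].
apply: (@le_trans _ _ (f (maxn n m, maxn n k))%:E); last by rewrite lee_fin H ?leq_maxl.
apply: ereal_inf_lbound; exists (maxn n m, maxn n k) => //; apply: PQ.
by split; [apply: Pm|apply: Qk]; rewrite /= leq_maxr.
Qed.

(** For the symmetry of the boundary product, whose lower limit is taken over pairs
    of indices. *)
Lemma limf_einf_swap (f : nat * nat -> R) :
  (limf_einf (fun ij => (f (ij.2, ij.1))%:E) (filter_prod \oo \oo) <=
   limf_einf (fun ij => (f ij)%:E) (filter_prod \oo \oo))%E.
Proof.
rewrite !limf_einfE; apply: ge_ereal_sup => _ [V [[P Q] [FP FQ] PQ] <-].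
apply: (@le_trans _ _ (ereal_inf ((fun ij => (f ij)%:E) @` (Q `*` P)))).
  apply: le_ereal_inf_tmp => _ [[i j] [/= Qi Pj] <-]; apply: ereal_inf_lbound.
  by exists (j, i) => //; apply: PQ.
by apply: ereal_sup_ubound; exists (Q `*` P) => //; exists (Q, P).
Qed.

Lemma boundary_product_sym (x y : bd) : boundary_product x y = boundary_product y x.
Proof.
suff H (a b : bd) : (boundary_product a b <= boundary_product b a)%E by apply/eqP; rewrite eq_le !H.
apply: le_ereal_inf_tmp => _ [u [v [bu av ->]]].
pose f (ij : nat * nat) := gp (sval u ij.1) (sval v ij.2).
apply: le_trans (limf_einf_swap f); apply: ereal_inf_lbound; exists v, u; split => //.
congr limf_einf; apply/funext => -[i j]; rewrite /f /= /gromov_product dsym.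
by congr (_ / 2)%:E; rewrite (dsym (sval u j)); ring.
Qed.

Lemma boundary_product_diag (x : bd) : boundary_product x x = +oo%E.
Proof.
apply/eqP; rewrite -leye_eq; apply: le_ereal_inf_tmp => _ [u [v [/endpointP ux /endpointP vx ->]]].
rewrite leye_eq; apply/eqP/eqyP => A A0.
have [n H] := converges_gp ux vx A.
exact: (@limf_einf_ge (fun ij => gp (sval u ij.1) (sval v ij.2)) A n).
Qed.

(** For sequences converging to distinct points the heights stop mattering, and
    [rho] is eventually within a factor [2] of [m]. *)
Lemma boundary_product_bounds (x y : bd) : x <> y ->
  let m := Num.min 1 (mdist (endpoint x) (endpoint y)) in
  [/\ 0 < m, ((- ln (2 * m) / alpha - C)%:E <= boundary_product x y)%E &
      (boundary_product x y <= (- ln (m / 2) / alpha + C)%:E)%E].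
Proof.
set D := mdist (endpoint x) (endpoint y) => xy m.
have D0 : 0 < D by rewrite mdist_gt0; apply/eqP => /endpoint_inj.
have m0 : 0 < m by rewrite /m lt_min ltr01.
have m1 : m <= 1 by rewrite /m ge_min lexx.
have mD : m <= D by rewrite /m ge_min lexx orbT.
have key (u v : gromov_sequence d x0) : sval x u -> sval y v ->
    exists n, forall i j, (n <= i)%N -> (n <= j)%N ->
      - ln (2 * m) / alpha - C <= gp (sval u i) (sval v j) <= - ln (m / 2) / alpha + C.
  move=> /endpointP ux /endpointP vy.
  have m4 : 0 < m / 4 by lra.
  have [n un] := ux _ m4; have [k vk] := vy _ m4; exists (maxn n k) => i j.
  rewrite !geq_max => /andP[ni ki] /andP[nj kj].
  have [h1 h2] := un i ni; have [h3 h4] := vk j kj.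
  have hD1 : D <= mdist (pr (sval u i)) (pr (sval v j)) + m / 2.
    have := metric_triangle (endpoint x) (pr (sval u i)) (endpoint y).
    have := metric_triangle (pr (sval u i)) (pr (sval v j)) (endpoint y).
    by rewrite -/D (metric_sym (endpoint x)); lra.
  have hD2 : mdist (pr (sval u i)) (pr (sval v j)) <= D + m / 2.
    have := metric_triangle (pr (sval u i)) (endpoint x) (pr (sval v j)).
    have := metric_triangle (endpoint x) (endpoint y) (pr (sval v j)).
    by rewrite -/D (metric_sym (endpoint y)); lra.
  have r0 := rho_gt0 alpha (lift (sval u i)) (lift (sval v j)).
  have r1 : lrho (sval u i) (sval v j) <= 2 * m.
    rewrite /rho !ge_max; apply/andP; split; first by apply/andP; split; lra.
    have [mE|mE] : m = 1 \/ m = D by rewrite /m; case: leP; [left|right].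
      by rewrite ge_min mE; apply/orP; left; lra.
    by rewrite ge_min; apply/orP; right; lra.
  have r2 : m / 2 <= lrho (sval u i) (sval v j).
    by rewrite /rho le_max le_min; apply/orP; right; apply/andP; split; lra.
  have := gpM (sval u i) (sval v j); rewrite ler_norml.
  have c1 : - ln (2 * m) / alpha <= confluence alpha (lift (sval u i)) (lift (sval v j)).
    by rewrite /confluence ler_pM2r ?invr_gt0// lerN2 ler_ln ?posrE; lra.
  have c2 : confluence alpha (lift (sval u i)) (lift (sval v j)) <= - ln (m / 2) / alpha.
    by rewrite /confluence ler_pM2r ?invr_gt0// lerN2 ler_ln ?posrE; lra.
  by move=> /andP[? ?]; apply/andP; split; lra.
split => //.
  apply: le_ereal_inf_tmp => _ [u [v [ux vy ->]]]; have [n H] := key u v ux vy.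
  apply: (@limf_einf_ge (fun ij => gp (sval u ij.1) (sval v ij.2)) _ n) => i j ni nj.
  by have /andP[] := H i j ni nj.
have [u ux] := converges_exists (endpoint x); have [v vy] := converges_exists (endpoint y).
have {}ux : sval x u by apply/endpointP.
have {}vy : sval y v by apply/endpointP.
have [n H] := key u v ux vy.
apply: le_trans (_ : limf_einf _ _ <= _)%E; first by apply: ereal_inf_lbound; exists u, v.
apply: (@limf_einf_le (fun ij => gp (sval u ij.1) (sval v ij.2)) _ n) => i j ni nj.
by have /andP[] := H i j ni nj.
Qed.

End boundary.

Section boundary_metric.
Context (R : realType) (Y : metricType R) (alpha : R) (Z : Type) (d : Z -> Z -> R)
  (x0 : Z) (lift : Z -> {nonneg R} * Y) (C Delta eps : R).
Hypotheses (a0 : 0 < alpha) (dsym : forall x y, d x y = d y x).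
Hypothesis gpM : forall x y,
  `|gromov_product d x0 x y - confluence alpha (lift x) (lift y)| <= C.
Hypothesis dense_lift : forall y (e : R), 0 < e ->
  exists z, expR (- (alpha * (lift z).1%:num)) < e /\ mdist (lift z).2 y < e.
Hypotheses (cY : is_complete Y) (D1 : 1 <= Delta)
  (bY : forall y y' : Y, mdist y y' <= Delta) (e0 : 0 < eps) (ea : eps <= alpha).

Let ep := endpoint a0 gpM cY.
Let th := eps / alpha.
Let A := expR (eps * C) * (2 * Delta) `^ th.

Let th0 : 0 < th. Proof. by rewrite divr_gt0. Qed.
Let th1 : th <= 1. Proof. by rewrite ler_pdivrMr// mul1r. Qed.
Let Dl0 : 0 < Delta. Proof. by apply: lt_le_trans D1. Qed.
Let A0 : 0 < A. Proof. by rewrite mulr_gt0 ?expR_gt0// powR_gt0// mulr_gt0. Qed.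

Lemma powRE_gt0 (x : R) : 0 < x -> expR (eps * (ln x / alpha)) = x `^ th.
Proof. by move=> x0'; rewrite /powR gt_eqF// /th mulrCA mulrC mulrAC -mulrA. Qed.

(** Exponentiate [boundary_product_bounds]; boundedness of [Y] makes [min (1, d)]
    comparable to [d]. *)
Lemma boundary_quasidist_bounds (x y : gromov_boundary d x0) :
  A^-1 * mdist (ep x) (ep y) `^ th <= boundary_quasidist eps x y <= A * mdist (ep x) (ep y) `^ th.
Proof.
have [<-|xy] := pselect (x = y).
  rewrite /boundary_quasidist (boundary_product_diag a0 gpM cY) mdistxx.
  by rewrite mulry gtr0_sg// mul1e/= powR0 ?gt_eqF// !mulr0 lexx.
have [m0 lo hi] := boundary_product_bounds a0 gpM dense_lift cY xy.
rewrite -/(ep x) -/(ep y) in m0 lo hi.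
set D := mdist _ _; rewrite -/D in m0 lo hi; set m := Num.min 1 D in m0 lo hi.
have mD : m <= D by rewrite /m ge_min lexx orbT.
have D0 : 0 < D by apply: lt_le_trans mD.
have Dm : D <= Delta * m.
  have [mE|mE] : m = 1 \/ m = D by rewrite /m; case: leP; [left|right].
    by rewrite mE mulr1; exact: bY.
  by rewrite mE ler_peMl// ltW.
have bfin : boundary_product x y \is a fin_num.
  rewrite fin_numE; apply/andP; split; apply/eqP => h.
    by move: lo; rewrite h leeNy_eq.
  by move: hi; rewrite h leye_eq.
rewrite /boundary_quasidist; rewrite -(fineK bfin) in lo hi *.
set r := fine _ in lo hi *; rewrite !lee_fin in lo hi.
rewrite -EFinM -EFinN /=.
have E (z : R) : 0 < z -> expR (- (eps * (- ln z / alpha))) = z `^ th.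
  by move=> z0; rewrite -powRE_gt0// mulNr mulrN opprK.
have h1 : (m / 2) `^ th * expR (- (eps * C)) <= expR (- (eps * r)).
  rewrite -E ?divr_gt0// -expRD ler_expR -opprD lerN2 -mulrDr ler_pM2l//.
have h2 : expR (- (eps * r)) <= (2 * m) `^ th * expR (eps * C).
  rewrite -E ?mulr_gt0// -expRD ler_expR.
  rewrite -[leRHS]opprK opprD opprK lerN2 -mulrBr ler_pM2l//.
apply/andP; split.
  apply: le_trans h1; rewrite /A invfM -expRN -mulrA mulrC ler_pM2r ?expR_gt0//.
  rewrite ler_pdivrMl ?powR_gt0 ?mulr_gt0// -powRM ?mulr_ge0 ?divr_ge0 ?(ltW m0) ?(ltW Dl0)//.
  apply: ge0_ler_powR; rewrite ?(ltW th0) ?nnegrE ?(ltW D0)//.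
    by rewrite !mulr_ge0 ?(ltW m0) ?(ltW Dl0).
  by rewrite mulrACA (mulrC 2) -mulrA; apply: le_trans Dm _; rewrite le_eqVlt; apply/orP; left; apply/eqP; field.
apply: le_trans h2 _; rewrite /A mulrC -mulrA ler_pM2l ?expR_gt0//.
rewrite -powRM ?mulr_ge0 ?(ltW Dl0) ?(ltW D0)//.
apply: ge0_ler_powR; rewrite ?(ltW th0) ?nnegrE ?mulr_ge0 ?(ltW D0) ?(ltW m0) ?(ltW Dl0)//.
rewrite -mulrA ler_pM2l//; apply: le_trans mD _.
by rewrite ler_peMl// ltW.
Qed.

(** Here [eps <= alpha] is essential: it makes [mdist `^ th] a metric, so that the
    chain distance is still comparable to it. *)
Lemma boundary_quasisymmetric :
  quasisymmetrically_homeomorphic (@boundary_dist R Z d x0 eps) (@mdist R Y).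
Proof.
have qsym (x y : gromov_boundary d x0) :
    boundary_quasidist eps x y = boundary_quasidist eps y x.
  by rewrite /boundary_quasidist (boundary_product_sym dsym).
pose e (x y : gromov_boundary d x0) := mdist (ep x) (ep y) `^ th.
have e_ge0 x y : 0 <= e x y by exact: powR_ge0.
have exx x : e x x = 0 by rewrite /e mdistxx powR0// gt_eqF.
have e_eq x y : e x y = 0 -> x = y.
  move=> h; apply: (@endpoint_inj _ _ _ _ _ _ _ _ a0 gpM cY).
  by apply: mdist_positivity; exact: powR_eq0_eq0 h.
have etri x y z : e x z <= e x y + e y z.
  apply: le_trans (powR_subadditive th0 th1 (mdist_ge0 _ _) (mdist_ge0 _ _)).
  apply: ge0_ler_powR; rewrite ?(ltW th0) ?nnegrE ?mdist_ge0 ?addr_ge0 ?mdist_ge0//.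
  exact: metric_triangle.
have lb x y : A^-1 * e x y <= boundary_quasidist eps x y.
  by have /andP[] := boundary_quasidist_bounds x y.
have ub x y : boundary_quasidist eps x y <= A * e x y.
  by have /andP[] := boundary_quasidist_bounds x y.
have /choice[g gP] := endpoint_surj a0 gpM dense_lift cY.
apply: (@snowflake_quasisymmetric R _ _ Y ep g th A th0 A0).
- exact: (chain_dist_metric A0 e_ge0 exx e_eq etri qsym lb ub).
- by move=> x; apply: (@endpoint_inj _ _ _ _ _ _ _ _ a0 gpM cY); exact: gP.
- exact: gP.
- exact: (chain_dist_lb A0 exx etri lb).
- exact: (chain_dist_ub A0 e_ge0 exx etri lb ub).
Qed.

End boundary_metric.

(** * Fillings with exponentially growing warping function *)

Section filling_theory.
Context (R : realType) (Y : metricType R) (Phi : R -> R) (alpha kappa B : R).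
Local Notation dY := (@mdist R Y).
Local Notation ed := (@euclid_dist R).
Hypotheses (a0 : 0 < alpha) (k0 : 0 < kappa) (B0 : 0 <= B).
Hypotheses (Phi_lb : forall u, 1 <= u -> kappa * expR (alpha * u) <= Phi u)
  (Phi_ub : forall u, 0 <= u -> Phi u <= expR (alpha * u))
  (Phi_B : forall y y', Phi 0 * dY y y' <= B).
Context (N : R * R -> R).
Hypotheses (nN : is_norm2 N) (uN : unitary_norm N) (cN : coordinate_increasing N).
Hypotheses (Phi_ge0 : forall x, 0 <= x -> 0 <= Phi x)
  (Phi_mono : forall x y, 0 <= x -> x <= y -> Phi x <= Phi y)
  (mPhi : measurable_fun [set: R] Phi) (lY : length_space dY).

Let phi (s : {nonneg R}) := Phi s%:num.
Let phi_ge0 s : 0 <= phi s. Proof. exact: Phi_ge0. Qed.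
Let W := warped_pdist N ed dY phi.
Let C := estimate_const alpha kappa B.
Let Q := warped_product N ed dY phi.
Let dQ : Q -> Q -> R := @warped_dist R N _ _ ed dY phi.

Let W_ge0 p q : 0 <= W p q.
Proof. exact: warped_pdist_ge0. Qed.
Let con := filling_connected nN uN cN phi_ge0 lY.
Let Wxx p : W p p = 0.
Proof.
exact: (warped_pdist_xx phi nN (@euclid_xx R) (@euclid_sym R) (@euclid_tri R)
  (@mdistxx R Y) (@metric_sym R Y) (@metric_triangle R Y)).
Qed.
Let Wsym p q : W p q = W q p.
Proof.
exact: (warped_pdist_sym nN (@euclid_xx R) (@euclid_sym R) (@euclid_tri R)
  (@mdistxx R Y) (@metric_sym R Y) (@metric_triangle R Y) con).
Qed.
Let Wtri p q r : W p r <= W p q + W q r.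
Proof.
exact: (warped_pdist_triangle nN (@euclid_xx R) (@euclid_sym R) (@euclid_tri R)
  (@mdistxx R Y) (@metric_sym R Y) (@metric_triangle R Y) con).
Qed.
Let WM p q : `|W p q - (p.1%:num + q.1%:num - 2 * confluence alpha p q)| <= C.
Proof. exact: filling_estimate. Qed.

Lemma warped_dist_metric : is_metric dQ.
Proof. exact: (quotient_metric W_ge0 Wxx Wsym Wtri). Qed.

Definition hyperbolicity_const (a k b : R) : R := 3 * estimate_const a k b + 2 * (ln 2 / a).

Lemma filling_hyperbolic : gromov_hyperbolic dQ (hyperbolicity_const alpha kappa B).
Proof.
split; first exact: warped_dist_metric.
  apply: addr_ge0; apply: mulr_ge0 => //; first exact: estimate_const_ge0.
  by rewrite divr_ge0 ?(ltW a0)// ln_ge0// ler1n.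
move=> x y z w.
exact: (@approx_four_point R _ W (fun p => p.1%:num) (confluence alpha) C (ln 2 / alpha)
  (@confluence_sym R Y alpha) (confluence_ultra a0) WM
  (quotient_repr x) (quotient_repr y) (quotient_repr z) (quotient_repr w)).
Qed.

Hypotheses (bY : is_bounded dY) (cY : is_complete Y).

(** Changing the base point from height [0] to [x0] moves Gromov products by at most
    the height of [x0]. This affects the multiplicative constants of the boundary
    distance but not the admissible range of [eps]. *)
Lemma filling_boundary (eps : R) (x0 : Q) : 0 < eps -> eps <= alpha ->
  quasisymmetrically_homeomorphic (@boundary_dist R _ dQ x0 eps) dY.
Proof.
move=> e0 ea; have [Delta0 D0] := bY.
pose Delta := Num.max 1 Delta0.
pose lift (z : Q) := quotient_repr z.
have dsym x y : dQ x y = dQ y x by have [] := warped_dist_metric.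
have gpM x y : `|gromov_product dQ x0 x y - confluence alpha (lift x) (lift y)| <=
    3 / 2 * C + (lift x0).1%:num.
  have := approx_gromov_product WM (lift x0) (lift x) (lift y).
  have := confluence_ge0 a0 (lift x) (lift x0); have := confluence_ge0 a0 (lift y) (lift x0).
  have [_] := confluence_le a0 (lift x) (lift x0); have [_] := confluence_le a0 (lift y) (lift x0).
  rewrite -[gromov_product W _ _ _]/(gromov_product dQ x0 x y) !ler_norml.
  by move=> ? ? ? ? /andP[? ?]; apply/andP; split; lra.
apply: (@boundary_quasisymmetric R Y alpha Q dQ x0 lift _ Delta eps a0 dsym gpM _ cY) => //.
- move=> y e e1; have m0 : 0 < Num.min e 1 by rewrite lt_min e1 ltr01.
  have me : Num.min e 1 <= e by rewrite ge_min lexx.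
  have m1 : Num.min e 1 <= 1 by rewrite ge_min lexx orbT.
  set m := Num.min e 1 in m0 me m1.
  (* the representative of the class of [(t, y)] can have another height and
     projection, but its confluence with [(t, y)] is at least [t - C] *)
  pose t := nng (C + 1 - ln m / alpha).
  have tE : t%:num = C + 1 - ln m / alpha.
    rewrite nngE// addr_ge0//; first by rewrite addr_ge0// estimate_const_ge0.
    by rewrite -mulNr divr_ge0 ?(ltW a0)// oppr_ge0 ln_le0.
  pose z : Q := quotient_class (fun p q => W p q = 0) (t, y).
  exists z; have Wz : W (lift z) (t, y) = 0 by exact: (quotient_class_repr Wxx Wsym).
  have := WM (lift z) (t, y); have [c1 _] := confluence_le a0 (lift z) (t, y).
  rewrite Wz sub0r normrN ler_norml => /andP[_ H].
  have : - ln m / alpha < confluence alpha (lift z) (t, y).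
    by rewrite /= tE in H; rewrite mulNr; lra.
  rewrite /confluence ltr_pM2r ?invr_gt0// ltrN2 ltr_ln ?posrE ?rho_gt0//.
  rewrite /rho !gt_max gt_min /= => /andP[/andP[h1 _] /orP[h2|h2]]; first by lra.
  by split; lra.
- by rewrite /Delta le_max lexx.
- move=> y y'; rewrite /Delta le_max; apply/orP; right.
  by apply: D0; exists (y, y').
Qed.

End filling_theory.

(** * The two warping functions *)

Section warpings.
Context (R : realType).
Implicit Types (u alpha : R).

Lemma expR_half u : 1 <= u -> expR (- u) <= expR u / 2.
Proof.
move=> u1; have h2 : 2 <= expR u by apply: le_trans (expR_ge1Dx u); lra.
rewrite expRN; apply: (@le_trans _ _ 1); last by lra.
by rewrite invf_le1 ?expR_gt0//; lra.
Qed.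

Lemma sinh_ge0 u : 0 <= u -> 0 <= sinh u.
Proof. by move=> u0; rewrite /sinh divr_ge0// subr_ge0 ler_expR; lra. Qed.

Lemma le_sinh u w : u <= w -> sinh u <= sinh w.
Proof.
move=> uw; rewrite /sinh ler_pM2r ?invr_gt0// lerB// ler_expR; lra.
Qed.

Lemma sinh_le_expR u : sinh u <= expR u.
Proof.
rewrite /sinh ler_pdivrMr//; have := expR_ge0 (- u); have := expR_ge0 u; lra.
Qed.

Lemma sinh_ge_expR u : 1 <= u -> 4^-1 * expR u <= sinh u.
Proof. by move=> /expR_half; rewrite /sinh; lra. Qed.

Lemma powR_expR u alpha : expR u `^ alpha = expR (alpha * u).
Proof. by rewrite /powR gt_eqF ?expR_gt0// expRK. Qed.

Lemma measurable_sinh : measurable_fun [set: R] (@sinh R).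
Proof.
apply: measurable_funM => //; apply: measurable_funB; first exact: measurable_expR.
by apply: measurableT_comp; first exact: measurable_expR.
Qed.

End warpings.

Section fillings.
Context (R : realType) (N : R * R -> R) (Y : metricType R) (alpha : R).
Hypotheses (nN : is_norm2 N) (uN : unitary_norm N) (cN : coordinate_increasing N)
  (lY : length_space (@mdist R Y)) (a0 : 0 < alpha).

Let PhiS (u : R) : R := sinh u `^ alpha.
Let PhiE (u : R) : R := expR (alpha * u).

Let S_lb u : 1 <= u -> 4^-1 `^ alpha * expR (alpha * u) <= PhiS u.
Proof.
move=> u1; rewrite -powR_expR -powRM ?expR_ge0 ?invr_ge0//.
apply: ge0_ler_powR; rewrite ?(ltW a0) ?nnegrE ?sinh_ge0 ?mulr_ge0 ?expR_ge0//; first lra.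
exact: sinh_ge_expR.
Qed.

Let S_mono x y : 0 <= x -> x <= y -> PhiS x <= PhiS y.
Proof.
move=> x0 xy; apply: ge0_ler_powR; rewrite ?(ltW a0) ?nnegrE ?sinh_ge0//; first lra.
exact: le_sinh.
Qed.

Let S_ub u : 0 <= u -> PhiS u <= expR (alpha * u).
Proof.
move=> u0; rewrite -powR_expR; apply: ge0_ler_powR;
  rewrite ?(ltW a0) ?nnegrE ?sinh_ge0 ?expR_ge0//.
exact: sinh_le_expR.
Qed.

Let S_B (y y' : Y) : PhiS 0 * mdist y y' <= 0.
Proof. by rewrite /PhiS /sinh oppr0 subrr mul0r powR0 ?gt_eqF// mul0r. Qed.

Let S_meas : measurable_fun [set: R] PhiS.
Proof. by apply: (measurableT_comp (measurable_powR alpha)); exact: measurable_sinh. Qed.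

Let k0 : 0 < (4^-1 : R) `^ alpha. Proof. by rewrite powR_gt0. Qed.

Lemma solid_filling_hyperbolic :
  gromov_hyperbolic (@filling_dist R N alpha Y) (hyperbolicity_const alpha (4^-1 `^ alpha) 0).
Proof.
exact: (filling_hyperbolic a0 k0 (lexx 0) S_lb S_ub S_B nN uN cN
  (fun x _ => powR_ge0 _ _) S_mono S_meas lY).
Qed.

Lemma solid_filling_boundary (eps : R) (x0 : filling N alpha Y) :
  is_bounded (@mdist R Y) -> is_complete Y -> 0 < eps -> eps <= alpha ->
  quasisymmetrically_homeomorphic
    (@boundary_dist R _ (@filling_dist R N alpha Y) x0 eps) (@mdist R Y).
Proof.
move=> bY cY e0 ea.
exact: (filling_boundary a0 k0 (lexx 0) S_lb S_ub S_B nN uN cN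
  (fun x _ => powR_ge0 _ _) S_mono S_meas lY bY cY x0 e0 ea).
Qed.

Hypothesis bY : is_bounded (@mdist R Y).
Let B := Num.max 0 (diam (@mdist R Y)).

Let B0 : 0 <= B. Proof. by rewrite /B le_max lexx. Qed.

Let E_lb u : 1 <= u -> 1 * expR (alpha * u) <= PhiE u.
Proof. by rewrite mul1r. Qed.

Let E_ub u : 0 <= u -> PhiE u <= expR (alpha * u).
Proof. by []. Qed.

Let E_B (y y' : Y) : PhiE 0 * mdist y y' <= B.
Proof.
rewrite /PhiE mulr0 expR0 mul1r /B le_max; apply/orP; right.
by apply: ub_le_sup => //; exists (y, y').
Qed.

Let E_mono x y : 0 <= x -> x <= y -> PhiE x <= PhiE y.
Proof. by move=> _ xy; rewrite /PhiE ler_expR ler_pM2l. Qed.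

Let E_meas : measurable_fun [set: R] PhiE.
Proof. by apply: measurableT_comp; [exact: measurable_expR|exact: measurable_funM]. Qed.

Lemma exp_filling_hyperbolic :
  gromov_hyperbolic (@filling0_dist R N alpha Y) (hyperbolicity_const alpha 1 B).
Proof.
exact: (filling_hyperbolic a0 ltr01 B0 E_lb E_ub E_B nN uN cN
  (fun x _ => expR_ge0 _) E_mono E_meas lY).
Qed.

Lemma exp_filling_boundary (eps : R) (x0 : filling0 N alpha Y) :
  is_complete Y -> 0 < eps -> eps <= alpha ->
  quasisymmetrically_homeomorphic
    (@boundary_dist R _ (@filling0_dist R N alpha Y) x0 eps) (@mdist R Y).
Proof.
move=> cY e0 ea.
exact: (filling_boundary a0 ltr01 B0 E_lb E_ub E_B nN uN cN
  (fun x _ => expR_ge0 _) E_mono E_meas lY bY cY x0 e0 ea).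
Qed.

End fillings.

Unset Implicit Arguments.

Theorem theorem1p7 (R : realType) :
  exists (delta1 : R -> R) (delta2 : R -> R -> R),
  forall (N : R * R -> R),
    is_norm2 N -> unitary_norm N -> coordinate_increasing N ->
  forall (Y : metricType R), length_space (@mdist R Y) ->
  forall alpha : R, 0 < alpha ->
  [/\ gromov_hyperbolic (@filling_dist R N alpha Y) (delta1 alpha),
      is_bounded (@mdist R Y) ->
        gromov_hyperbolic (@filling0_dist R N alpha Y)
          (delta2 alpha (diam (@mdist R Y))) &
      is_bounded (@mdist R Y) -> is_complete Y ->
        exists2 eps0 : R, 0 < eps0 &
        forall eps : R, 0 < eps -> eps <= eps0 ->
          (forall x0 : filling N alpha Y,
             quasisymmetrically_homeomorphic
               (@boundary_dist R _ (@filling_dist R N alpha Y) x0 eps)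
               (@mdist R Y)) /\
          (forall x0 : filling0 N alpha Y,
             quasisymmetrically_homeomorphic
               (@boundary_dist R _ (@filling0_dist R N alpha Y) x0 eps)
               (@mdist R Y))].
Proof.
exists (fun alpha => hyperbolicity_const alpha (4^-1 `^ alpha) 0),
  (fun alpha D => hyperbolicity_const alpha 1 (Num.max 0 D)).
move=> N nN uN cN Y lY alpha a0; split => [|bY|bY cY].
- exact: solid_filling_hyperbolic.
- exact: exp_filling_hyperbolic.
- exists alpha => // eps e0 ea; split => x0.
    exact: solid_filling_boundary.
  exact: exp_filling_boundary.
Qed.
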